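(* Let $k=7$. The IMEX-WSBDF7 scheme defined by $$\boldsymbol{A}^{(7)}=\left[\tfrac{1049}{140},-\tfrac{239}{10},\tfrac{75}{2},-40,\tfrac{355}{12},-\tfrac{141}{10},\tfrac{39}{10},-\tfrac{10}{21}\right]^\top,\quad \boldsymbol{B}^{(7)}=[3,-2,0,0,0,0,0,0]^\top,$$ $$\hat{\boldsymbol{B}}^{(7)}=[19,-63,105,-105,63,-21,3]^\top$$ together with the multiplier coefficient vector $\boldsymbol{\mu}=\frac15[20,-21,3,12,-16,11,-4]^\top$ satisfies the feasibility conditions (FP) of the context with $\alpha=1/4$ and $\beta=1/100$. Hence the scheme admits modified energy dissipation: for the gradient flow in the setting of the context, $E_G^{n+1}\le E_G^n$ (for $k-1\le n\le N-1$) whenever $0<\tau\le\tau_{\max}$. The corresponding positive definite matrices $G_a,G_B$ in the modified energy $E_G^n$ satisfy the positive-definiteness conditions (PDC) of the context (with these $\alpha,\beta$) and are given by $$G_a=\frac1{100}\begin{bmatrix}2544&-4320&4139&-2754&1180&-280\\-4320&8677&-8828&5955&-2694&684\\4139&-8828&9693&-6738&3061&-774\\-2754&5955&-6738&5054&-2459&660\\1180&-2694&3061&-2459&1432&-433\\-280&684&-774&660&-433&164\end{bmatrix},$$ $$G_B=\frac1{10000}\begin{bmatrix}103511&-129612&43554&38296&-69378&50646&-17017\\-129612&198687&-118031&1837&63785&-59721&22055\\43554&-118031&146214&-97072&28484&8221&-8370\\38296&1837&-97072&137157&-106715&50284&-11787\\-69378&63785&28484&-106715&121949&-77349&23224\\50646&-59721&8221&50284&-77349&60692&-21773\\-17017&22055&-8370&-11787&23224&-21773&9668\end{bmatrix}.$$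 In particular, the constant $\hat c_0$ appearing in $\tau_{\max}$ equals $33856/5$.
   Context: Abstract setting. $\Omega=(-\pi,\pi)^d$, $d\in\{1,2,3\}$, with periodic boundary conditions; $(v,w)=\int_\Omega vw\,\mathrm{d}\boldsymbol{x}$, $\|v\|=(v,v)^{1/2}$. $H$ is a Hilbert space with inner product $(\cdot,\cdot)$ and norm $\|\cdot\|$; $S,V$ are Hilbert spaces with $S\hookrightarrow V\hookrightarrow H$ (continuous and compact embeddings); $V'$ is the dual of $V$ and $V\subset H\subset V'$ is a Gelfand triple with duality pairing $\langle\cdot,\cdot\rangle_{V',V}$. $\mathcal{L}:S\to V$ is linear with $(\mathcal{L}u,v)=(u,\mathcal{L}v)$ and $(\mathcal{L}v,v)\ge 0$ for $u,v\in S$; $\|\mathcal{L}^{1/2}u\|:=(\mathcal{L}u,u)^{1/2}$. $\mathcal{M}:V\to V'$ is linear and self-adjoint, $\langle\mathcal{M}u,v\rangle_{V',V}=\langle\mathcal{M}v,u\rangle_{V',V}$, and there are constants $C_{\mathcal M},c_{\mathcal M}>0$ with $|\langle\mathcal{M}u,v\rangle_{V',V}|\le C_{\mathcal M}\|u\|_V\|v\|_V$ and $-\langle\mathcal{M}v,v\rangle_{V',V}\ge c_{\mathcal M}\|v\|_V^2$ for all $u,v\in V$; hence $\mathcal{M}^{-1}:V'\to V$ is bounded, self-adjoint and negative definite. For $v\in H$, $\|(-\mathcal{M})^{-1/2}v\|:=(v,-\mathcal{M}^{-1}v)^{1/2}$. There exist constants $\zeta>0$ and $0<\eta\le 1$ with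 $\|v\|\le\zeta\|(-\mathcal{M})^{-1/2}v\|^{\eta}\|\mathcal{L}^{1/2}v\|^{1-\eta}$ for all $v\in S$. Nonlinearity. $f(u)=F'(u)$ for a potential $F$, with $(F(u),1):=\int_\Omega F(u)\,\mathrm{d}\boldsymbol{x}\ge 0$. $f:S\to V$ is globally Lipschitz: $\|f(u)-f(v)\|\le\ell_f\|u-v\|$ for all $u,v\in S$ ($\ell_f>0$), and (as a consequence) $|(F(u)-F(v),1)-(f(v),u-v)|\le\frac{\ell_f}{2}\|u-v\|^2$ for all $u,v\in S$. Gradient flow: $u_t=\mathcal{M}[\mathcal{L}u+f(u)]$, $u(0)=u^0$, on $(0,T]$. Scheme. Let $\tau=T/N$, $t_n=n\tau$. Given $u^0,\ldots,u^{k-1}\in S$, the $k$-step IMEX-LMM with coefficient vectors $\boldsymbol{A}^{(k)}=[A_0^{(k)},\ldots,A_k^{(k)}]^\top$, $\boldsymbol{B}^{(k)}=[B_0^{(k)},\ldots,B_k^{(k)}]^\top$, $\hat{\boldsymbol{B}}^{(k)}=[\hat B_1^{(k)},\ldots,\hat B_k^{(k)}]^\top$ is, for $k-1\le n\le N-1$ (with solution $u^{n+1}\in S$), $$\sum_{i=0}^kA_i^{(k)}u^{n+1-i}=\tau\mathcal{M}\Big[\sum_{i=0}^kB_i^{(k)}\mathcal{L}u^{n+1-i}+\sum_{i=1}^k\hat B_i^{(k)}f(u^{n+1-i})\Big].$$ The coefficients satisfy the order conditions $\sum_{i=0}^kA_i^{(k)}=0$ and, for $0\le m\le k-1$, $\sum_{i=0}^kA_i^{(k)}(-i)^{m+1}=(m+1)\sum_{i=0}^kB_i^{(k)}(-i)^m=(m+1)\sum_{i=1}^k\hat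 B_i^{(k)}(-i)^m$, and the normalization $\sum_{i=0}^kA_i^{(k)}(-i)=\sum_{i=0}^kB_i^{(k)}=\sum_{i=1}^k\hat B_i^{(k)}=1$; given $\boldsymbol{B}^{(k)}$, the order conditions determine $\boldsymbol{A}^{(k)}$ and $\hat{\boldsymbol{B}}^{(k)}$ uniquely. Convention: $0^0=1$ throughout. Put $\delta u^j=u^j-u^{j-1}$, $a_i^{(k)}=\sum_{j=0}^iA_j^{(k)}$ ($0\le i\le k-1$), $\hat b_i^{(k)}=\sum_{j=1}^i\hat B_j^{(k)}-1$ ($1\le i\le k-1$), $\boldsymbol{a}^{(k)}=[a_0^{(k)},\ldots,a_{k-1}^{(k)}]^\top$. Multiplier. For $\boldsymbol{\mu}=[\mu_0,\ldots,\mu_{k-1}]^\top$, let $\boldsymbol{\nu}=[\nu_0,\ldots,\nu_k]^\top$ with $\nu_0=\mu_0$, $\nu_k=-\mu_{k-1}$, $\nu_i=\mu_i-\mu_{i-1}$ ($1\le i\le k-1$). Generating polynomial: for $\boldsymbol{s}=[s_0,\ldots,s_r]^\top$, $M(z;\boldsymbol{s})=\sum_{i=0}^rs_iz^{r-i}$. Feasibility conditions (FP) for $(\boldsymbol{B}^{(k)},\boldsymbol{\mu},\alpha,\beta)$ with $\alpha,\beta>0$: $\sum_{i=0}^kB_i^{(k)}=1$, $\sum_{i=0}^{k-1}\mu_i=1$, and (a) $\deg M(z;\boldsymbol{a}^{(k)})=\deg M(z;\boldsymbol{\mu})=k-1$, $\deg M(z;\boldsymbol{B}^{(k)})=k$;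 (b) all roots of $M(z;\boldsymbol{\mu})$ lie in the open unit disk; (c) $M(z;\boldsymbol{a}^{(k)})$ and $M(z;\boldsymbol{\mu})$ are coprime, and $M(z;\boldsymbol{B}^{(k)})$ and $M(z;\boldsymbol{\nu})$ are coprime; (d) $P_a(x)\ge\alpha$ and $P_B(x)\ge\beta$ for all $x\in[-1,1]$, where $P_a,P_B$ are the polynomials in $x$ determined by $$P_a(\cos\theta)=\operatorname{Re}\{M(\mathrm{e}^{\mathrm{i}\theta};\boldsymbol{a}^{(k)})M(\mathrm{e}^{-\mathrm{i}\theta};\boldsymbol{\mu})\}\ (\theta\in[0,\pi]),\quad P_B(\cos\theta)=\frac{\operatorname{Re}\{M(\mathrm{e}^{\mathrm{i}\theta};\boldsymbol{B}^{(k)})M(\mathrm{e}^{-\mathrm{i}\theta};\boldsymbol{\nu})\}}{2(1-\cos\theta)}\ (\theta\in(0,\pi]),$$ $P_B$ being continuously extended to $x=1$. Positive-definiteness conditions (PDC): for all $\boldsymbol{x}\in\mathbb{R}^k$, $\boldsymbol{y}\in\mathbb{R}^{k+1}$, $\boldsymbol{x}^\top U_a\boldsymbol{x}\ge\alpha x_1^2$ and $\boldsymbol{y}^\top U_B\boldsymbol{y}\ge\beta(y_1-y_2)^2$, where ($\boldsymbol{0}_m$ the zero vector in $\mathbb{R}^m$) $$U_a=\tfrac12\big(\boldsymbol{\mu}(\boldsymbol{a}^{(k)})^\top+\boldsymbol{a}^{(k)}\boldsymbol{\mu}^\top\big)-\begin{bmatrix}G_a&\boldsymbol{0}_{k-1}\\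 \boldsymbol{0}_{k-1}^\top&0\end{bmatrix}+\begin{bmatrix}0&\boldsymbol{0}_{k-1}^\top\\ \boldsymbol{0}_{k-1}&G_a\end{bmatrix},$$ $$U_B=\tfrac12\big(\boldsymbol{\nu}(\boldsymbol{B}^{(k)})^\top+\boldsymbol{B}^{(k)}\boldsymbol{\nu}^\top\big)-\begin{bmatrix}G_B&\boldsymbol{0}_{k}\\ \boldsymbol{0}_{k}^\top&0\end{bmatrix}+\begin{bmatrix}0&\boldsymbol{0}_{k}^\top\\ \boldsymbol{0}_{k}&G_B\end{bmatrix}.$$ Modified energy. For vectors of functions and a matrix $G=(g_{ij})$, $(\boldsymbol{w},\boldsymbol{v})_G=\sum_{i,j}g_{ij}(w^i,v^j)$; linear operators act componentwise. With $\boldsymbol{v}_n=[\delta u^n,\ldots,\delta u^{n+2-k}]^\top$, $\boldsymbol{u}_n=[u^n,\ldots,u^{n+1-k}]^\top$, $$E_G^n=-\frac1\tau(\boldsymbol{v}_n,\mathcal{M}^{-1}\boldsymbol{v}_n)_{G_a}+(\boldsymbol{u}_n,\mathcal{L}\boldsymbol{u}_n)_{G_B}+\sum_{i=0}^{k-1}\mu_i(F(u^{n-i}),1)+\frac{\ell_f}{2}\sum_{i=1}^{k-1}\hat c_i\|\delta u^{n+1-i}\|^2,$$ where $\hat c_i=\sum_{j=i}^{k-1}\tilde c_j$ ($0\le i\le k-1$) and, with $\delta_{i,0}$ the Kronecker delta, $$\tilde c_i=(1-\delta_{i,0})|\hat b_i^{(k)}|\sum_{j=0}^{k-1}|\mu_j|+|\mu_i|\sum_{j=1}^{k-1}|\hat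 b_j^{(k)}|+|\mu_i|+\Big(|\mu_i|+\sum_{j=i}^{k-1}j|\mu_j|\Big)(1-\delta_{i,0}).$$ Time-step bound: with $\bar\eta=\frac{1-\eta}{\eta}$, $$\tau_{\max}=\frac{\alpha\beta^{\bar\eta}}{(\ell_f\hat c_0/2)^{1+\bar\eta}\,\eta\,(1-\eta)^{\bar\eta}\,\zeta^{2+2\bar\eta}}.$$ *)

(* Defs.v *)
From Stdlib Require Import BinInt.
From HB Require Import structures.
From mathcomp Require Import all_boot all_order all_algebra.
From mathcomp Require Import sesquilinear complex ssrZ.
From mathcomp Require Import all_classical all_reals all_analysis.

Set Implicit Arguments.
Unset Strict Implicit.
Unset Printing Implicit Defensive.

Import Order.TTheory GRing.Theory Num.Theory.
Import numFieldNormedType.Exports.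

Local Open Scope classical_set_scope.
Local Open Scope ring_scope.

(* A k-step method is written with k = m.+1, so that coefficient vectors have
   type 'cV_m.+1 or 'cV_m.+2.  [s`_[i]] reads the entry of index i : nat; it is
   only meaningful for i <= r when s : 'cV_r.+1. *)
Definition entry (R : realType) (r : nat) (s : 'cV[R]_r.+1) (i : nat) : R :=
  s (inord i) 0.
Notation "s `_[ i ]" := (entry s i)
  (at level 3, i at level 200, left associativity,
   format "s `_[ i ]") : ring_scope.

Section coefficients.
Variables (R : realType) (m : nat).
Implicit Types (A B : 'cV[R]_m.+2) (Bh mu : 'cV[R]_m.+1).

(* The vector \hat B = [\hat B_1, ..., \hat B_k] is indexed from 1, so that
   \hat B_i is the entry of index i.-1. *)

(* Here 0 ^+ 0 = 1. *)
Definition order_conditions A B Bh : Prop :=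
  [/\ \sum_(0 <= i < m.+2) A`_[i] = 0,
      forall q : nat, (q <= m)%N ->
        \sum_(0 <= i < m.+2) A`_[i] * (- i%:R) ^+ q.+1
          = q.+1%:R * \sum_(0 <= i < m.+2) B`_[i] * (- i%:R) ^+ q
        /\ q.+1%:R * (\sum_(0 <= i < m.+2) B`_[i] * (- i%:R) ^+ q)
          = q.+1%:R * \sum_(1 <= i < m.+2) Bh`_[i.-1] * (- i%:R) ^+ q,
      \sum_(0 <= i < m.+2) A`_[i] * (- i%:R) = 1,
      \sum_(0 <= i < m.+2) B`_[i] = 1
    & \sum_(1 <= i < m.+2) Bh`_[i.-1] = 1].

Definition a_coef A : 'cV[R]_m.+1 := \col_i \sum_(0 <= j < i.+1) A`_[j].

Definition bhat Bh (i : nat) : R := \sum_(1 <= j < i.+1) Bh`_[j.-1] - 1.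

Definition nu_coef mu : 'cV[R]_m.+2 :=
  \col_i (if i == 0%N :> nat then mu`_[0]
          else if i == m.+1 :> nat then - mu`_[m]
          else mu`_[i] - mu`_[i.-1]).

Definition ctilde Bh mu (i : nat) : R :=
  (1 - (i == 0%N)%:R) * `|bhat Bh i| * (\sum_(0 <= j < m.+1) `|mu`_[j]|)
  + `|mu`_[i]| * (\sum_(1 <= j < m.+1) `|bhat Bh j|)
  + `|mu`_[i]|
  + (`|mu`_[i]| + \sum_(i <= j < m.+1) j%:R * `|mu`_[j]|) * (1 - (i == 0%N)%:R).

Definition chat Bh mu (i : nat) : R := \sum_(i <= j < m.+1) ctilde Bh mu j.

End coefficients.

Section feasibility.
Variable R : realType.

Definition genpoly (r : nat) (s : 'cV[R]_r.+1) : {poly R} :=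
  \sum_(0 <= i < r.+1) s`_[i] *: 'X^(r - i).

Definition cgenpoly (r : nat) (s : 'cV[R]_r.+1) : {poly R[i]} :=
  map_poly (real_complex R) (genpoly s).

Definition expi (t : R) : R[i] := Complex (cos t) (sin t).

Definition re_product (r : nat) (s s' : 'cV[R]_r.+1) (t : R) : R :=
  complex.Re ((cgenpoly s).[expi t] * (cgenpoly s').[expi (- t)]).

(* [A] is meant to be the vector determined by [B] through
   [order_conditions].  A polynomial of degree n has size n.+1.  The
   polynomials P_a and P_B are unique when they exist; evaluating P_B at 1 is
   its continuous extension there. *)
Definition feasible (m : nat) (A B : 'cV[R]_m.+2) (mu : 'cV[R]_m.+1)
    (alpha beta : R) : Prop :=
  let a := a_coef A in
  let nu := nu_coef mu in
  [/\ 0 < alpha /\ 0 < beta,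
      \sum_(0 <= i < m.+2) B`_[i] = 1 /\ \sum_(0 <= i < m.+1) mu`_[i] = 1,
      [/\ size (genpoly a) = m.+1, size (genpoly mu) = m.+1
        & size (genpoly B) = m.+2],
      forall z : R[i], root (cgenpoly mu) z -> `|z| < 1
    & [/\ coprimep (genpoly a) (genpoly mu),
          coprimep (genpoly B) (genpoly nu)
        & exists Pa PB : {poly R},
          [/\ forall t : R, 0 <= t <= pi -> Pa.[cos t] = re_product a mu t,
              forall t : R, 0 < t <= pi ->
                PB.[cos t] = re_product B nu t / (2 * (1 - cos t))
            & forall x : R, -1 <= x <= 1 -> alpha <= Pa.[x] /\ beta <= PB.[x]]]].

Definition shift_corners (m : nat) (G : 'M[R]_m) : 'M[R]_m.+1 :=
  block_mx (0 : 'M[R]_1) 0 0 G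
  - castmx (addn1 m, addn1 m) (block_mx G 0 0 (0 : 'M[R]_1)).

Definition U_mx (m : nat) (p q : 'cV[R]_m.+1) (G : 'M[R]_m) : 'M[R]_m.+1 :=
  2^-1 *: (p *m q^T + q *m p^T) + shift_corners G.

Definition qform (n : nat) (U : 'M[R]_n) (x : 'cV[R]_n) : R :=
  (x^T *m U *m x) 0 0.

Definition posdef (n : nat) (G : 'M[R]_n) : Prop :=
  G^T = G /\ forall x : 'cV[R]_n, x != 0 -> 0 < qform G x.

Definition pos_def_conditions (m : nat) (A B : 'cV[R]_m.+2) (mu : 'cV[R]_m.+1)
    (alpha beta : R) (Ga : 'M[R]_m) (GB : 'M[R]_m.+1) : Prop :=
  (forall x : 'cV[R]_m.+1,
     alpha * x`_[0] ^+ 2 <= qform (U_mx mu (a_coef A) Ga) x) /\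
  (forall y : 'cV[R]_m.+2,
     beta * (y`_[0] - y`_[1]) ^+ 2 <= qform (U_mx (nu_coef mu) B GB) y).

End feasibility.

HB.mixin Record NormedModule_isHilbert (R : realType) T
    of CompleteNormedModule R T := {
  inner : {dot T for (@idfun R)};
  inner_norm : forall x : T, inner x x = `|x| ^+ 2
}.

#[short(type="hilbertType")]
HB.structure Definition Hilbert (R : realType) :=
  {T of NormedModule_isHilbert R T & CompleteNormedModule R T}.

(* R^n (n >= 1), as an iterated product of copies of R, with its Borel sets,
   its Lebesgue measure and a distinguished subset. *)
Record domain (R : realType) := Domain {
  dom_disp : measure_display;
  dom_type : measurableType dom_disp;
  dom_measure : {measure set dom_type -> \bar R};
  dom_set : set dom_type
}.
Arguments dom_measure {R} d.
Arguments dom_set {R} d.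

Fixpoint cube_rec (R : realType) (n : nat) : domain R :=
  if n is n'.+1 then
    let D := cube_rec R n' in
    @Domain R _ (dom_type D * measurableTypeR R)%type
      (dom_measure D \x @lebesgue_measure R)%E
      (dom_set D `*` `]- pi, pi[)
  else @Domain R _ (measurableTypeR R) (@lebesgue_measure R) `]- pi, pi[.

(* (- pi, pi)^d in R^d, for d >= 1 *)
Definition cube (R : realType) (d : nat) : domain R := cube_rec R d.-1.

Definition compact_embedding (R : realType) (U W : normedModType R)
    (j : U -> W) : Prop :=
  [/\ injective j, continuous j
    & compact (closure (j @` [set x | `|x| <= 1]))].

(* elements of the topological dual *)
Definition dual_elt (R : realType) (V : normedModType R) (phi : V -> R^o) :=
  linear phi /\ continuous phi.


(* The abstract setting.  The elements of H are square-integrable functions on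
   Omega = (- pi, pi)^d: [rho u] is a representative of u.  Since [rho]
   preserves the inner products, it is automatically linear and injective up to
   almost everywhere equality.  Periodicity is part of S and V.  An element of
   V' is a function on V that satisfies [dual_elt]; by coercivity, [opM] is a
   bijection from V onto V', hence [invM phi] is the preimage of phi. *)
Record gradient_flow (R : realType) (d : nat) := GradientFlow {
  Omega := dom_set (cube R d);
  dx := dom_measure (cube R d);

  spS : hilbertType R;
  spV : hilbertType R;
  spH : hilbertType R;

  rho : spH -> dom_type (cube R d) -> R;
  rho_measurable : forall u, measurable_fun Omega (rho u);
  rho_square : forall u, dx.-integrable Omega (EFin \o (fun x => rho u x ^+ 2));
  rho_inner : forall u v,
    inner u v = \int[dx]_(x in Omega) (rho u x * rho v x);

  iSV : {linear spS -> spV};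
  iVH : {linear spV -> spH};
  iSV_compact : compact_embedding iSV;
  iVH_compact : compact_embedding iVH;
  iVH_dense : dense (range iVH);
  iSH := (fun u => iVH (iSV u)) : spS -> spH;

  opL : {linear spS -> spV};
  opL_symmetric : forall u v, inner (iVH (opL u)) (iSH v)
                              = inner (iSH u) (iVH (opL v));
  opL_ge0 : forall v, 0 <= inner (iVH (opL v)) (iSH v);
  normL := (fun v => Num.sqrt (inner (iVH (opL v)) (iSH v))) : spS -> R;

  opM : {linear spV -> (spV -> R^o)};
  opM_dual : forall u, dual_elt (opM u);
  opM_symmetric : forall u v, opM u v = opM v u;
  opM_bounded : exists2 CM : R, 0 < CM &
    forall u v, `|opM u v| <= CM * `|u| * `|v|;
  opM_coercive : exists2 cM : R, 0 < cM &
    forall v : spV, cM * `|v| ^+ 2 <= - opM v v;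

  (* the embedding of H into V', and the operator M^-1 : V' -> V *)
  iHV' := (fun h w => inner h (iVH w)) : spH -> (spV -> R^o);
  invM := (fun phi => xget 0 [set v | opM v = phi]) : (spV -> R^o) -> spV;
  invMH := (fun h => iVH (invM (iHV' h))) : spH -> spH;
  normM := (fun h => Num.sqrt (inner h (- invMH h))) : spH -> R;

  zeta : R;
  eta : R;
  zeta_gt0 : 0 < zeta;
  eta_bounds : 0 < eta <= 1;
  interpolation : forall v : spS,
    `|iSH v| <= zeta * normM (iSH v) `^ eta * normL v `^ (1 - eta);

  potential : R -> R;
  potential_derivable : forall x : R, derivable potential x 1;
  intF := (fun u => \int[dx]_(x in Omega) potential (rho (iSH u) x)) : spS -> R;
  potential_integrable : forall u : spS,
    dx.-integrable Omega (EFin \o (fun x => potential (rho (iSH u) x)));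
  intF_ge0 : forall u, 0 <= intF u;

  opf : spS -> spV;
  fE : forall u, {ae dx, forall x, Omega x ->
    rho (iVH (opf u)) x = derive1 potential (rho (iSH u) x)};
  lipf : R;
  lipf_gt0 : 0 < lipf;
  f_lipschitz : forall u v,
    `|iVH (opf u) - iVH (opf v)| <= lipf * `|iSH u - iSH v|;
  f_taylor : forall u v,
    `|intF u - intF v - inner (iVH (opf v)) (iSH u - iSH v)|
      <= lipf / 2 * `|iSH u - iSH v| ^+ 2
}.

Section scheme.
Variables (R : realType) (d m : nat) (E : gradient_flow R d).
Variables (A B : 'cV[R]_m.+2) (Bh mu : 'cV[R]_m.+1).
Variables (tau : R) (u : nat -> spS E).

(* an equation in V', for k - 1 <= n <= N - 1 *)
Definition imex_lmm (N : nat) : Prop :=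
  forall n : nat, (m <= n < N)%N ->
  \sum_(0 <= i < m.+2) A`_[i] *: iHV' (iSH (u (n.+1 - i)%N))
  = tau *: opM E (\sum_(0 <= i < m.+2) B`_[i] *: opL E (u (n.+1 - i)%N)
                  + \sum_(1 <= i < m.+2) Bh`_[i.-1] *: opf (u (n.+1 - i)%N)).

Definition delta (j : nat) : spH E := iSH (u j) - iSH (u j.-1).

Definition inner_G (r : nat) (G : 'M[R]_r) (w v : 'I_r -> spH E) : R :=
  \sum_i \sum_j G i j * inner (w i) (v j).

Definition energy (Ga : 'M[R]_m) (GB : 'M[R]_m.+1) (n : nat) : R :=
  - tau^-1 * inner_G Ga (fun i => delta (n - i)%N)
                        (fun i => invMH (delta (n - i)%N))
  + inner_G GB (fun i => iSH (u (n - i)%N))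
               (fun i => iVH E (opL E (u (n - i)%N)))
  + \sum_(0 <= i < m.+1) mu`_[i] * intF (u (n - i)%N)
  + lipf E / 2 * \sum_(1 <= i < m.+1) chat Bh mu i * `|delta (n.+1 - i)%N| ^+ 2.

Definition tau_max (alpha beta : R) : R :=
  let eb := (1 - eta E) / eta E in
  alpha * beta `^ eb
  / ((lipf E * chat Bh mu 0 / 2) `^ (1 + eb) * eta E
     * (1 - eta E) `^ eb * zeta E `^ (2 + 2 * eb)).

End scheme.

(* Numerals of R are unary, hence large integers are written in the binary
   type Z, whose literals get the delimiter BZ (Z denotes int_scope here). *)
Delimit Scope Z_scope with BZ.

Section wsbdf7.
Local Open Scope Z_scope.

Definition wsbdf7_Ga_rows : seq (seq Z) :=
  [:: [:: 2544; -4320; 4139; -2754; 1180; -280];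
      [:: -4320; 8677; -8828; 5955; -2694; 684];
      [:: 4139; -8828; 9693; -6738; 3061; -774];
      [:: -2754; 5955; -6738; 5054; -2459; 660];
      [:: 1180; -2694; 3061; -2459; 1432; -433];
      [:: -280; 684; -774; 660; -433; 164]].

Definition wsbdf7_GB_rows : seq (seq Z) :=
  [:: [:: 103511; -129612; 43554; 38296; -69378; 50646; -17017];
      [:: -129612; 198687; -118031; 1837; 63785; -59721; 22055];
      [:: 43554; -118031; 146214; -97072; 28484; 8221; -8370];
      [:: 38296; 1837; -97072; 137157; -106715; 50284; -11787];
      [:: -69378; 63785; 28484; -106715; 121949; -77349; 23224];
      [:: 50646; -59721; 8221; 50284; -77349; 60692; -21773];
      [:: -17017; 22055; -8370; -11787; 23224; -21773; 9668]].

Local Close Scope Z_scope.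

Variable R : realType.

Definition ofZ (z : Z) : R := (int_of_Z z)%:~R.

Definition colv (r : nat) (s : seq R) : 'cV[R]_r := \col_i s`_i.

Definition mx_of_rows (r : nat) (rows : seq (seq Z)) : 'M[R]_r :=
  \matrix_(i, j) ofZ (nth Z0 (nth [::] rows i) j).

Definition wsbdf7_A : 'cV[R]_8 :=
  colv 8 [:: 1049 / 140; - 239 / 10; 75 / 2; - 40; 355 / 12; - 141 / 10;
             39 / 10; - 10 / 21].

Definition wsbdf7_B : 'cV[R]_8 := colv 8 [:: 3; - 2; 0; 0; 0; 0; 0; 0].

Definition wsbdf7_Bh : 'cV[R]_7 :=
  colv 7 [:: 19; - 63; 105; - 105; 63; - 21; 3].

Definition wsbdf7_mu : 'cV[R]_7 :=
  5^-1 *: colv 7 [:: 20; - 21; 3; 12; - 16; 11; - 4].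

Definition wsbdf7_Ga : 'M[R]_6 := (ofZ 100)^-1 *: mx_of_rows 6 wsbdf7_Ga_rows.

Definition wsbdf7_GB : 'M[R]_7 := (ofZ 10000)^-1 *: mx_of_rows 7 wsbdf7_GB_rows.

End wsbdf7.

(* Main.v *)
Require Import Defs.
From Stdlib Require Import BinInt.
From Stdlib Require Znat.
From mathcomp Require Import all_boot all_order all_algebra.
From mathcomp Require Import ring lra zify complex ssrZ sesquilinear.
From mathcomp Require Import all_classical all_reals all_analysis.

Set Implicit Arguments.
Unset Strict Implicit.
Unset Printing Implicit Defensive.

Import Order.TTheory GRing.Theory Num.Theory.
Import numFieldNormedType.Exports.

Local Open Scope classical_set_scope.
Local Open Scope ring_scope.

(** The proof rests on one algebraic identity that is used with three different
    forms.  Let K be a positive semidefinite symmetric form on a real vector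
    space, let p and q be coefficient vectors and x a list of vectors.  By the
    definition of the matrix U built from p, q and G,
    K(sum p_i x_i, sum q_i x_i) is the sum of U_ij K(x_i, x_j), plus the G-form
    of the list without its last entry, minus the G-form of the list without
    its first entry ([multiplier_identity]).  When x is a window that slides
    along a sequence, the two G-forms are consecutive values of an energy.  A
    real symmetric matrix with nonnegative quadratic form also satisfies
    sum U_ij K(x_i, x_j) >= 0 ([gform_psd]), so that the two inequalities of
    the positive-definiteness conditions hold for every such K, with the square
    of a real number y replaced by K(y, y).

    On the complex plane, K(z, w) = Re(z * conj w) and x_i = z ^ (m - i).  The
    window shifts by a factor z, and the identity becomes
    Re(M(z; p) conj M(z; q)) = (U-part) + (|z|^2 - 1) (G-part).
    On the unit circle this gives the lower bounds for P_a and P_B; at a root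
    of M(z; mu) the left-hand side vanishes, which forces |z| < 1.  Hence the
    positive-definiteness conditions imply the analytic part of feasibility
    ([feasible_of_pos_def]).

    For the dissipation, the scheme is tested against -M^-1 applied to
    h = sum mu_i delta u^{n+1-i} = sum nu_i u^{n+1-i}.  The identity is used
    with the forms of -M^-1 and of L, and yields the differences of the first
    two terms of the energy, plus alpha and beta times the forms at
    delta u^{n+1}.  The explicit nonlinear term is the difference of the
    potentials up to an error at most l/2 sum c~_i |delta u^{n+1-i}|^2, where l
    is the Lipschitz constant of f
    ([nonlinear_defect]); the last term of the energy telescopes so that only
    l/2 c^_0 |delta u^{n+1}|^2 remains ([chat_telescope]).  The interpolation
    inequality and the weighted arithmetic-geometric inequality absorb it into
    the alpha and beta terms as soon as tau <= tau_max
    ([interpolation_absorb]).  Since M^-1 is obtained by inverting M between V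
    and V', the Riesz representation theorem is needed for the form of -M
    ([riesz_representation]).

    What concerns the particular coefficients is decided by integer
    arithmetic: symmetric Gaussian elimination for the matrices
    ([psdZ_sound]) and the Euclidean algorithm for coprimality
    ([coprimeZ_sound]). *)

(** * Matrices acting on positive semidefinite forms *)

Section psd_forms.
Variable R : realType.

Definition psd_form (V : lmodType R) (K : V -> V -> R) : Prop :=
  [/\ forall a x y z, K (a *: x + y) z = a * K x z + K y z,
      forall x y, K x y = K y x
    & forall x, 0 <= K x x].

(** The pairing of U with the Gram matrix of x for the form K. *)
Definition gform (V : lmodType R) (n : nat) (U : 'M[R]_n) (K : V -> V -> R)
    (x : 'I_n -> V) : R :=
  \sum_i \sum_j U i j * K (x i) (x j).

(** With this form, [gform] is the ordinary quadratic form of a matrix. *)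
Lemma psd_form_mul : psd_form (fun a b : R^o => (a * b : R)).
Proof.
split=> [a x y z|x y|x]; first by rewrite mulrDl -mulrA.
- by rewrite mulrC.
- exact: sqr_ge0.
Qed.

Lemma qformE n (U : 'M[R]_n) (x : 'cV[R]_n) :
  qform U x = gform U (fun a b : R^o => (a * b : R)) (fun i => x i 0).
Proof.
rewrite /qform /gform -mulmxA mxE; apply: eq_bigr => i _.
rewrite !mxE mulr_sumr; apply: eq_bigr => j _.
by rewrite mulrCA.
Qed.

Section one_form.
Variables (V : lmodType R) (K : V -> V -> R).
Hypothesis Kpsd : psd_form K.

Lemma psd_form0l y : K 0 y = 0.
Proof.
have [lin _ _] := Kpsd; have := lin 1 0 0 y.
by rewrite scaler0 addr0 mul1r => /eqP; rewrite -subr_eq subrr eq_sym => /eqP.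
Qed.

Lemma psd_formDl x y z : K (x + y) z = K x z + K y z.
Proof. by have [lin _ _] := Kpsd; rewrite -[x]scale1r lin mul1r scale1r. Qed.

Lemma psd_formZl a x z : K (a *: x) z = a * K x z.
Proof.
by have [lin _ _] := Kpsd; rewrite -[a *: x]addr0 lin psd_form0l addr0.
Qed.

Lemma psd_formDr x y z : K x (y + z) = K x y + K x z.
Proof. by have [_ sym _] := Kpsd; rewrite !(sym x) psd_formDl. Qed.

Lemma psd_formZr a x z : K x (a *: z) = a * K x z.
Proof. by have [_ sym _] := Kpsd; rewrite !(sym x) psd_formZl. Qed.

Lemma psd_form_suml (I : Type) (r : seq I) (P : pred I) (x : I -> V) y :
  K (\sum_(i <- r | P i) x i) y = \sum_(i <- r | P i) K (x i) y.
Proof.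
apply: (big_morph (fun z => K z y)) => [u v|]; first exact: psd_formDl.
exact: psd_form0l.
Qed.

Lemma psd_form_sumr (I : Type) (r : seq I) (P : pred I) (x : I -> V) y :
  K y (\sum_(i <- r | P i) x i) = \sum_(i <- r | P i) K y (x i).
Proof.
have [_ sym _] := Kpsd; rewrite sym psd_form_suml.
by apply: eq_bigr => i _; rewrite sym.
Qed.

Lemma psd_form_lin n (p q : 'cV[R]_n) (x : 'I_n -> V) :
  K (\sum_i p i 0 *: x i) (\sum_j q j 0 *: x j) = gform (p *m q^T) K x.
Proof.
rewrite psd_form_suml; apply: eq_bigr => i _.
rewrite psd_form_sumr; apply: eq_bigr => j _.
by rewrite psd_formZl psd_formZr !mxE big_ord1 mxE mulrA.
Qed.

Lemma gformD n (U W : 'M[R]_n) x :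
  gform (U + W) K x = gform U K x + gform W K x.
Proof.
rewrite -big_split; apply: eq_bigr => i _; rewrite -big_split.
by apply: eq_bigr => j _; rewrite mxE mulrDl.
Qed.

Lemma gformZ n a (U : 'M[R]_n) x : gform (a *: U) K x = a * gform U K x.
Proof.
rewrite mulr_sumr; apply: eq_bigr => i _; rewrite mulr_sumr.
by apply: eq_bigr => j _; rewrite mxE mulrA.
Qed.

Lemma gform_tr n (U : 'M[R]_n) x : gform U^T K x = gform U K x.
Proof.
have [_ sym _] := Kpsd; rewrite /gform exchange_big; apply: eq_bigr => i _.
by apply: eq_bigr => j _; rewrite mxE sym.
Qed.

Lemma gform_scalar n a (x : 'I_n -> V) :
  gform a%:M K x = a * \sum_i K (x i) (x i).
Proof.
rewrite mulr_sumr; apply: eq_bigr => i _.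
rewrite (bigD1 i) //= big1 ?addr0 ?mxE ?eqxx // => j.
by rewrite mxE eq_sym => /negPf ->; rewrite mul0r.
Qed.

(** The Schur complement of the first diagonal entry, multiplied by that entry:
    no division occurs, hence the elimination can be run on integers. *)
Definition schur n (U : 'M[R]_n.+1) : 'M[R]_n :=
  \matrix_(i, j) (U 0 0 * U (lift ord0 i) (lift ord0 j)
                  - U 0 (lift ord0 i) * U 0 (lift ord0 j)).

Lemma schur_sym n (U : 'M[R]_n.+1) : U^T = U -> (schur U)^T = schur U.
Proof.
move=> Us; have UC i j : U i j = U j i by rewrite -{1}Us mxE.
by apply/matrixP => i j; rewrite !mxE (UC (lift ord0 j)) [X in _ - X]mulrC.
Qed.

(** Completing the square in the first vector; this is one step of Gaussian
    elimination, valid for any symmetric bilinear form. *)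
Lemma gform_schur n (U : 'M[R]_n.+1) (x : 'I_n.+1 -> V) : U^T = U ->
  let y := \sum_i U 0 i *: x i in
  U 0 0 * gform U K x = K y y + gform (schur U) K (fun i => x (lift ord0 i)).
Proof.
move=> Us y; have [_ sym _] := Kpsd.
have UC i j : U i j = U j i by rewrite -{1}Us mxE.
pose w := \sum_(i < n) U 0 (lift ord0 i) *: x (lift ord0 i).
have -> : y = U 0 0 *: x 0 + w by rewrite /y big_ord_recl.
have gE : gform (schur U) K (fun i => x (lift ord0 i)) =
    U 0 0 * gform (\matrix_(i, j) U (lift ord0 i) (lift ord0 j)) K
              (fun i => x (lift ord0 i)) - K w w.
  have -> : K w w = gform ((\col_i U 0 (lift ord0 i)) *m
      (\col_i U 0 (lift ord0 i))^T) K (fun i => x (lift ord0 i)).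
    rewrite -psd_form_lin; congr K;
      by apply: eq_bigr => i _; rewrite mxE.
  rewrite -mulN1r -!gformZ -gformD; congr (gform _ K _).
  apply/matrixP => i j; rewrite !mxE big_ord1 !mxE; ring.
rewrite {}gE psd_formDl !psd_formDr !psd_formZl !psd_formZr (sym w).
rewrite {1}/gform big_ord_recl big_ord_recl.
under [X in _ + X]eq_bigr do rewrite big_ord_recl.
rewrite big_split /=.
have -> : K (x 0) w = \sum_(i < n) U 0 (lift ord0 i) * K (x 0) (x (lift ord0 i)).
  by rewrite psd_form_sumr; apply: eq_bigr => i _; rewrite psd_formZr.
have -> : \sum_(i < n) U (lift ord0 i) ord0 * K (x (lift ord0 i)) (x ord0) =
   \sum_(i < n) U 0 (lift ord0 i) * K (x 0) (x (lift ord0 i)).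
  by apply: eq_bigr => i _; rewrite UC sym.
have -> : gform (\matrix_(i, j) U (lift ord0 i) (lift ord0 j)) K
     (fun i => x (lift ord0 i)) = \sum_(i < n) \sum_(j < n)
   U (lift ord0 i) (lift ord0 j) * K (x (lift ord0 i)) (x (lift ord0 j)).
  by apply: eq_bigr => i _; apply: eq_bigr => j _; rewrite mxE.
ring.
Qed.

End one_form.

Lemma sum_sqr_gt0 n (x : 'cV[R]_n) : x != 0 -> 0 < \sum_i x i 0 * x i 0.
Proof.
move=> x0; rewrite lt_def sumr_ge0 ?andbT => [|i _]; last exact: sqr_ge0.
apply: contra x0 => /eqP/psumr_eq0P x0; apply/eqP/matrixP => i j.
rewrite ord1 mxE; apply/eqP; rewrite -sqrf_eq0 expr2.
by rewrite x0 // => k _; exact: sqr_ge0.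
Qed.

(** Induction on the size.  Eliminating the first vector leaves a square
    K(y, y) and the form of the Schur complement; the latter is again positive
    definite, because a real vector t extends to one that annihilates y. *)
Lemma gform_posdef (V : lmodType R) (K : V -> V -> R) n (U : 'M[R]_n) x :
  psd_form K -> posdef U -> 0 <= gform U K x.
Proof.
move=> Kpsd; elim: n U x => [|n IH] U x [Us Upos].
  by rewrite /gform big_ord0.
(* extension of U 0 0 *: t by the first entry that makes the square vanish *)
pose ext (t : 'cV[R]_n) : 'cV[R]_n.+1 :=
  \col_i (if unlift ord0 i is Some j then U 0 0 * t j 0
          else - \sum_j U 0 (lift ord0 j) * t j 0).
have d_gt0 : 0 < U 0 0.
  have e0 : delta_mx 0 0 != 0 :> 'cV[R]_n.+1.
    apply/eqP => /matrixP/(_ 0 0); rewrite !mxE !eqxx /= => /eqP.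
    by rewrite oner_eq0.
  by have := Upos _ e0; rewrite /qform trmx_delta -rowE -colE !mxE.
have Spos : posdef (schur U).
  split=> [|t t0]; first exact: schur_sym.
  have e0 : ext t != 0.
    apply: contra_neq t0 => /matrixP e0; apply/matrixP => i j.
    rewrite ord1 mxE; have := e0 (lift ord0 i) 0; rewrite !mxE liftK => /eqP.
    by rewrite mulf_eq0 gt_eqF //= => /eqP.
  have := mulr_gt0 d_gt0 (Upos _ e0); rewrite qformE.
  rewrite (gform_schur psd_form_mul _ Us) /=.
  rewrite (_ : \sum_i _ = 0) => [|].
    rewrite mul0r add0r => H; rewrite qformE.
    have d2 : 0 < U 0 0 ^+ 2 by rewrite exprn_gt0.
    rewrite -(pmulr_rgt0 _ d2) /gform mulr_sumr; congr (0 < _): H.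
    apply: eq_bigr => i _; rewrite mulr_sumr; apply: eq_bigr => j _.
    by rewrite !mxE !liftK; ring.
  rewrite big_ord_recl /= mxE unlift_none.
  rewrite [X in _ + X](_ : _ =
     \sum_i U 0 0 * (U 0 (lift ord0 i) * t i 0)) => [|].
    by rewrite -mulr_sumr scalerN /GRing.scale /= addNr.
  by apply: eq_bigr => i _; rewrite mxE liftK /GRing.scale /= mulrCA.
rewrite -(pmulr_rge0 _ d_gt0) (gform_schur Kpsd _ Us) addr_ge0 ?IH //.
by have [_ _] := Kpsd.
Qed.

(** The semidefinite case is the limit e -> 0 of the definite case for
    U + e *: 1. *)
Lemma gform_psd (V : lmodType R) (K : V -> V -> R) n (U : 'M[R]_n) x :
  psd_form K -> U^T = U -> (forall t, 0 <= qform U t) -> 0 <= gform U K x.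
Proof.
move=> Kpsd Us Upsd; have [_ _ Kge0] := Kpsd.
have e_pos e : 0 < e -> 0 <= gform U K x + e * \sum_i K (x i) (x i).
  move=> e_gt0; rewrite -gform_scalar -gformD //; apply: gform_posdef => //.
  split=> [|t t0]; first by rewrite linearD /= Us tr_scalar_mx.
  rewrite qformE gformD -qformE gform_scalar ltr_wpDl // mulr_gt0 //.
  exact: sum_sqr_gt0.
have S_ge0 : 0 <= \sum_i K (x i) (x i) by rewrite sumr_ge0.
apply/ler_addgt0Pr => e e_gt0.
have := e_pos (e / (1 + \sum_i K (x i) (x i))).
rewrite divr_gt0 ?ltr_pwDl // => /(_ isT) /le_trans; apply.
rewrite lerD2l -mulrA ler_piMr ?(ltW e_gt0) // mulrC ler_pdivrMr ?ltr_pwDl // mul1r.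
by rewrite lerDr.
Qed.

(** Apply [gform_psd] to U - c *: (l *m l^T). *)
Lemma gform_lower (V : lmodType R) (K : V -> V -> R) n (U : 'M[R]_n) (l : 'cV[R]_n)
    (c : R) (x : 'I_n -> V) :
  psd_form K -> U^T = U ->
  (forall t : 'cV[R]_n, c * (\sum_i l i 0 * t i 0) ^+ 2 <= qform U t) ->
  let y := \sum_i l i 0 *: x i in c * K y y <= gform U K x.
Proof.
move=> Kpsd Us lb; rewrite /= -subr_ge0 addrC psd_form_lin // -mulNr -gformZ -gformD.
apply: gform_psd => // [|t].
  by rewrite linearD linearZ /= trmx_mul trmxK Us.
rewrite qformE gformD gformZ addrC.
rewrite -(psd_form_lin psd_form_mul) -qformE mulNr subr_ge0.
exact: lb.
Qed.

End psd_forms.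

(** * The multiplier identity *)

Section multiplier.
Variable R : realType.

(** The form in which the entries can be computed from tables of numbers. *)
Lemma shift_cornersE m (G : 'M[R]_m) (g : nat -> nat -> R) :
  (forall i j, G i j = g i j) ->
  forall i j, shift_corners G i j =
    (if (0 < i)%N && (0 < j)%N then g i.-1 j.-1 else 0)
    - (if (i < m)%N && (j < m)%N then g i j else 0).
Proof.
move=> GE i j.
have -> : shift_corners G i j = block_mx (0 : 'M[R]_1) 0 0 G i j
   - block_mx G 0 0 (0 : 'M[R]_1) (cast_ord (esym (addn1 m)) i)
       (cast_ord (esym (addn1 m)) j).
  by rewrite mxE [X in _ + X]mxE castmxE.
congr (_ - _).
  case: (split_ordP (i : 'I_(1 + m))) => i' ei;
    have /= Ei := congr1 (@nat_of_ord _) ei; rewrite Ei ei {Ei ei};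
    case: (split_ordP (j : 'I_(1 + m))) => j' ej;
    have /= Ej := congr1 (@nat_of_ord _) ej; rewrite Ej ej {Ej ej};
    rewrite ?block_mxEul ?block_mxEur ?block_mxEdl ?block_mxEdr ?ord1 ?mxE //=.
case: (split_ordP (cast_ord (esym (addn1 m)) i)) => i' ei;
  have /= Ei := congr1 (@nat_of_ord _) ei; rewrite ?Ei ei {Ei ei};
  case: (split_ordP (cast_ord (esym (addn1 m)) j)) => j' ej;
  have /= Ej := congr1 (@nat_of_ord _) ej; rewrite ?Ej ej {Ej ej};
  rewrite ?block_mxEul ?block_mxEur ?block_mxEdl ?block_mxEdr ?ord1 ?mxE /=
      ?ltn_ord ?addn0 ?ltnn ?andbF //=.
Qed.

Lemma shift_corners_tr m (G : 'M[R]_m) :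
  G^T = G -> (shift_corners G)^T = shift_corners G.
Proof.
move=> Gs; rewrite /shift_corners linearB /= trmx_cast /=.
rewrite !tr_block_mx !trmx0 Gs; congr (_ - _).
by have := tr_block_mx (0 : 'M[R]_1) 0 0 G; rewrite !trmx0 Gs.
Qed.

Lemma U_mx_tr m (p q : 'cV[R]_m.+1) (G : 'M[R]_m) :
  G^T = G -> (U_mx p q G)^T = U_mx p q G.
Proof.
move=> Gs; rewrite /U_mx linearD linearZ /= shift_corners_tr // linearD /=.
by rewrite !trmx_mul !trmxK addrC [X in _ *: X]addrC addrC.
Qed.

Lemma gform_shift (V : lmodType R) (K : V -> V -> R) m (G : 'M[R]_m) x :
  gform (shift_corners G) K x
  = gform G K (fun i => x (lift ord0 i))
    - gform G K (fun i => x (widen_ord (leqnSn m) i)).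
Proof.
have shiftE i j : shift_corners G i j = block_mx (0 : 'M[R]_1) 0 0 G i j
   - block_mx G 0 0 (0 : 'M[R]_1) (cast_ord (esym (addn1 m)) i)
       (cast_ord (esym (addn1 m)) j).
  by rewrite mxE [X in _ + X]mxE castmxE.
rewrite /gform.
under eq_bigr do under eq_bigr do rewrite shiftE mulrBl.
under eq_bigr do rewrite big_split /=.
rewrite big_split /=; congr (_ + _).
  have l0 (i : 'I_m) : lift ord0 i = rshift 1 i by exact: val_inj.
  rewrite big_ord_recl big1 ?add0r => [|j _]; last first.
    rewrite (_ : ord0 = lshift m (0 : 'I_1)); last exact: val_inj.
    case: (split_ordP (j : 'I_(1 + m))) => k ->;
      by rewrite ?block_mxEul ?block_mxEur mxE mul0r.
  apply: eq_bigr => i _; rewrite big_ord_recl.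
  rewrite (_ : block_mx _ _ _ _ _ _ = 0) ?mul0r ?add0r; last first.
    rewrite l0 (_ : ord0 = lshift m (0 : 'I_1)); last exact: val_inj.
    by rewrite block_mxEdl mxE.
  by apply: eq_bigr => j _; rewrite !l0 block_mxEdr.
have cw (i : 'I_m) : cast_ord (esym (addn1 m)) (widen_ord (leqnSn m) i)
  = lshift 1 i by exact: val_inj.
have cm : cast_ord (esym (addn1 m)) ord_max = rshift m (0 : 'I_1).
  by apply: val_inj; rewrite /= addn0.
rewrite -sumrN big_ord_recr /= [X in _ + X]big1 ?addr0 => [|j _]; last first.
  rewrite cm; case: (split_ordP (cast_ord (esym (addn1 m)) j)) => k ->;
    by rewrite ?block_mxEdl ?block_mxEdr mxE mul0r oppr0.
apply: eq_bigr => i _; rewrite big_ord_recr /= cw cm block_mxEur mxE.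
rewrite mul0r oppr0 addr0 -sumrN; apply: eq_bigr => j _.
by rewrite cw block_mxEul.
Qed.

(** The symmetrized product p q^T contributes K(sum p_i x_i, sum q_i x_i); the
    shifted corners contribute the difference of the two G-forms. *)
Lemma multiplier_identity (V : lmodType R) (K : V -> V -> R) m
    (p q : 'cV[R]_m.+1) (G : 'M[R]_m) (x : 'I_m.+1 -> V) : psd_form K ->
  K (\sum_i p i 0 *: x i) (\sum_i q i 0 *: x i)
  = gform (U_mx p q G) K x
    + gform G K (fun i => x (widen_ord (leqnSn m) i))
    - gform G K (fun i => x (lift ord0 i)).
Proof.
move=> Kpsd; rewrite gformD // gform_shift gformZ gformD.
rewrite -[q *m p^T]trmxK trmx_mul trmxK gform_tr // -psd_form_lin //.
by field.
Qed.

End multiplier.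

(** * Feasibility from positive definiteness *)

Section unit_circle.
Variable R : realType.

(** Re(z * conj w), on the complex numbers seen as a real vector space. *)
Definition cform (z w : Rcomplex R) : R :=
  complex.Re z * complex.Re w + complex.Im z * complex.Im w.

Lemma cform_psd : psd_form cform.
Proof.
split=> [a [x1 x2] [y1 y2] [z1 z2]|[x1 x2] [y1 y2]|[x1 x2]]; rewrite /cform /=.
- ring.
- ring.
- by rewrite addr_ge0 // -expr2 sqr_ge0.
Qed.

Lemma cformM (z a b : R[i]) : cform (z * a) (z * b) = cform z z * cform a b.
Proof.
by case: z a b => [z1 z2] [a1 a2] [b1 b2]; rewrite /cform /=; ring.
Qed.

Lemma cform_expi t : cform (expi t) (expi t) = 1.
Proof. by rewrite /cform /= -!expr2 cos2Dsin2. Qed.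

Lemma cform_exp (z : R[i]) n : cform (z ^+ n) (z ^+ n) = cform z z ^+ n.
Proof.
elim: n => [|n IH]; first by rewrite !expr0 /cform /= mulr1 mulr0 addr0.
by rewrite !exprS cformM IH.
Qed.

Lemma entryE r (s : 'cV[R]_r.+1) (i : 'I_r.+1) : s`_[i] = s i 0.
Proof. by rewrite /entry inord_val. Qed.

Lemma entry0 r (s : 'cV[R]_r.+1) : s`_[0] = s 0 0.
Proof. exact: (entryE s 0). Qed.

Lemma cgenpolyE r (s : 'cV[R]_r.+1) (z : R[i]) :
  (cgenpoly s).[z] = \sum_(i < r.+1) s i 0 *: (z ^+ (r - i) : Rcomplex R).
Proof.
rewrite /cgenpoly /genpoly big_mkord rmorph_sum horner_sum; apply: eq_bigr => i _.
rewrite /= map_polyZ map_polyXn hornerZ hornerXn entryE.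
case: (z ^+ _) => a b; apply/eqP; rewrite eq_complex /= !mul0r subr0 addr0.
by rewrite !eqxx.
Qed.

Lemma re_productE r (s s' : 'cV[R]_r.+1) t :
  re_product s s' t = cform (cgenpoly s).[expi t] (cgenpoly s').[expi t].
Proof.
have cE : cgenpoly s' = map_poly (@conjc R) (cgenpoly s').
  rewrite /cgenpoly -map_poly_comp; apply: eq_map_poly => x /=.
  by rewrite oppr0.
rewrite /re_product (_ : expi (- t) = conjc (expi t)); last first.
  by rewrite /expi cosN sinN.
rewrite {1}cE horner_map /cform.
by case: ((cgenpoly s).[_]) ((cgenpoly s').[_]) => [a b] [c d] /=; ring.
Qed.

(** Along the powers of z, dropping the last entry instead of the first
    multiplies the vectors by z, and [cform] by |z|^2. *)
Lemma multiplier_identity_at m (p q : 'cV[R]_m.+1) (G : 'M[R]_m) (z : R[i]) :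
  cform (cgenpoly p).[z] (cgenpoly q).[z]
  = gform (U_mx p q G) cform (fun i => z ^+ (m - i))
    + (cform z z - 1) * gform G cform (fun i => z ^+ (m - i.+1)).
Proof.
rewrite !cgenpolyE (multiplier_identity p q G _ cform_psd) -addrA mulrBl mul1r.
congr (_ + (_ - _)); rewrite /gform mulr_sumr; apply: eq_bigr => i _.
rewrite mulr_sumr; apply: eq_bigr => j _ /=.
by rewrite mulrCA -cformM -!exprS -!subSn.
Qed.

(** Real polynomials in e^{it} have a real part polynomial in cos t and an
    imaginary part sin t times a polynomial in cos t: this is the source of the
    polynomials P_a and P_B. *)
Lemma horner_expi (p : {poly R}) : exists P Q : {poly R}, forall t,
  (map_poly (real_complex R) p).[expi t] = Complex P.[cos t] (sin t * Q.[cos t]).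
Proof.
elim/poly_ind: p => [|p c [P [Q IH]]].
  by exists 0, 0 => t; rewrite rmorph0 !horner0 mulr0.
exists (P * 'X - (1 - 'X ^+ 2) * Q + c%:P), (P + 'X * Q) => t.
rewrite rmorphD rmorphM /= map_polyX map_polyC /= !hornerE.
rewrite {}IH -sin2cos2 /expi; congr Complex; ring.
Qed.

Lemma re_product_poly r (s s' : 'cV[R]_r.+1) :
  exists P : {poly R}, forall t, P.[cos t] = re_product s s' t.
Proof.
have [P [Q PQ]] := horner_expi (genpoly s).
have [P' [Q' PQ']] := horner_expi (genpoly s').
exists (P * P' + (1 - 'X ^+ 2) * (Q * Q')) => t.
rewrite re_productE /cgenpoly PQ PQ' /cform !hornerE -sin2cos2 /=; ring.
Qed.

(** By continuity; needed because t = 0 is excluded from the equation for P_B. *)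
Lemma horner_ge_closed (p : {poly R}) (c : R) :
  (forall x, -1 <= x < 1 -> c <= p.[x]) -> forall x, -1 <= x <= 1 -> c <= p.[x].
Proof.
move=> pc x /andP[x1]; rewrite le_eqVlt => /orP[/eqP ->|x2]; last first.
  by apply: pc; rewrite x1.
rewrite leNgt; apply/negP => p1.
have /nbhs_ballP[e /= e0 be] : \forall y \near (1 : R), p.[y] < c.
  have /cvgr_lt h : p.[y] @[y --> (1 : R)] --> p.[1] by exact: continuous_horner.
  exact: h p1.
pose y := 1 - Num.min (e / 2) 1.
have m0 : 0 < Num.min (e / 2) 1 :> R by rewrite lt_min divr_gt0 /=.
have m1 : Num.min (e / 2) 1 <= 1 :> R by rewrite ge_min lexx orbT.
have m2 : Num.min (e / 2) 1 <= e / 2 by rewrite ge_min lexx.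
have /be : ball (1 : R) e y.
  rewrite /ball /= /y opprB addrC subrK gtr0_norm //; lra.
by apply/negP; rewrite -leNgt; apply: pc; rewrite /y; lra.
Qed.

Lemma size_genpoly r (s : 'cV[R]_r.+1) : s 0 0 != 0 -> size (genpoly s) = r.+1.
Proof.
move=> s0; have -> : genpoly s = \poly_(i < r.+1) s`_[r - i].
  rewrite poly_def /genpoly big_mkord (reindex_inj rev_ord_inj) /=.
  by apply: eq_bigr => i _; rewrite subSS subKn // -ltnS.
by rewrite size_poly_eq // subnn entry0.
Qed.

Lemma nu_coefE m (mu : 'cV[R]_m.+1) (i : 'I_m.+2) :
  nu_coef mu i 0 = (if (i < m.+1)%N then mu`_[i] else 0)
                   - (if (0 < i)%N then mu`_[i.-1] else 0).
Proof.
rewrite mxE; case: i => -[|i] /= im; first by rewrite subr0.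
rewrite eqSS ltnS; have := im; rewrite !ltnS leq_eqVlt => /orP[/eqP ->|im'].
  by rewrite eqxx ltnn sub0r.
by rewrite ltn_eqF // im'.
Qed.

(** Summation by parts: the nu-combination of values is the mu-combination of
    increments. *)
Lemma sum_nu_coef (V : lmodType R) m (mu : 'cV[R]_m.+1) (x : nat -> V) :
  \sum_(i < m.+2) nu_coef mu i 0 *: x i
  = \sum_(i < m.+1) mu i 0 *: (x i - x i.+1).
Proof.
under eq_bigr do rewrite nu_coefE scalerBl.
rewrite big_split /= big_ord_recr /= ltnn scale0r addr0 sumrN [X in _ - X]big_ord_recl /=.
rewrite scale0r add0r -sumrB; apply: eq_bigr => i _.
by rewrite ltn_ord entryE scalerBr.
Qed.

(** Partial sums invert [nu_coef], because the total sum vanishes; hence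
    [sum_nu_coef] also applies to the left-hand side of the scheme. *)
Lemma nu_a_coef m (A : 'cV[R]_m.+2) : \sum_(0 <= i < m.+2) A`_[i] = 0 ->
  nu_coef (a_coef A) = A.
Proof.
move=> A0; apply/matrixP => i j; rewrite ord1 nu_coefE {j}.
have aE k : (k < m.+1)%N -> (a_coef A)`_[k] = \sum_(0 <= j < k.+1) A`_[j].
  by move=> km; rewrite (entryE _ (Ordinal km)) mxE.
case: i => -[|i] /= im.
  by rewrite aE // big_nat1 subr0 entry0; congr (A _ 0); apply: val_inj.
rewrite -(entryE A (Ordinal im)) /=.
rewrite (aE i) //; move: im; rewrite ltnS leq_eqVlt => /orP[/eqP [im]|im].
  by move: A0; rewrite im ltnn big_nat_recr //= => /eqP; rewrite addr_eq0 => /eqP ->;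
    rewrite sub0r opprK.
by rewrite im aE // big_nat_recr //= addrAC subrr add0r.
Qed.

Section pos_def_forms.
Variables (m : nat) (A B : 'cV[R]_m.+2) (mu : 'cV[R]_m.+1) (alpha beta : R).
Variables (Ga : 'M[R]_m) (GB : 'M[R]_m.+1).
Hypothesis pd : pos_def_conditions A B mu alpha beta Ga GB.
Variables (V : lmodType R) (K : V -> V -> R).
Hypothesis Kpsd : psd_form K.

Lemma pos_def_form_a (x : 'I_m.+1 -> V) : Ga^T = Ga ->
  alpha * K (x 0) (x 0) <= gform (U_mx mu (a_coef A) Ga) K x.
Proof.
move=> Gs; pose l : 'cV[R]_m.+1 := delta_mx 0 0.
have sum_l (W : lmodType R) (y : 'I_m.+1 -> W) : \sum_i l i 0 *: y i = y 0.
  rewrite (bigD1 0) //= big1 ?addr0 => [|i /negPf i0].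
    by rewrite mxE !eqxx scale1r.
  by rewrite mxE i0 scale0r.
rewrite -(sum_l V); apply: gform_lower => //; first exact: U_mx_tr.
move=> t; rewrite (sum_l R^o (fun i => t i 0)) -entry0; exact: pd.1.
Qed.

Lemma pos_def_form_B (x : 'I_m.+2 -> V) : GB^T = GB ->
  let y := x 0 - x (lift ord0 ord0) in
  beta * K y y <= gform (U_mx (nu_coef mu) B GB) K x.
Proof.
move=> Gs; pose l : 'cV[R]_m.+2 := delta_mx 0 0 - delta_mx (lift ord0 ord0) 0.
have sum_l (W : lmodType R) (y : 'I_m.+2 -> W) :
    \sum_i l i 0 *: y i = y 0 - y (lift ord0 ord0).
  rewrite big_ord_recl big_ord_recl big1 => [|i _].
    by rewrite !mxE /= subr0 sub0r scale1r scaleN1r addr0.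
  by rewrite !mxE /= subrr scale0r.
rewrite /= -(sum_l V); apply: gform_lower => //; first exact: U_mx_tr.
move=> t; rewrite (sum_l R^o (fun i => t i 0)) -entry0.
rewrite -(entryE t (lift ord0 ord0)); exact: pd.2.
Qed.

End pos_def_forms.

(** The lower bounds of (d) are those of the positive-definiteness conditions at
    the powers of e^{it}, where the G-part disappears.  At a root z of M(.; mu)
    with |z| >= 1 the identity would express 0 as a positive number plus a
    nonnegative one. *)
Theorem feasible_of_pos_def m (A B : 'cV[R]_m.+2) (mu : 'cV[R]_m.+1)
    (alpha beta : R) (Ga : 'M[R]_m) (GB : 'M[R]_m.+1) :
  0 < alpha -> 0 < beta ->
  \sum_(0 <= i < m.+2) B`_[i] = 1 -> \sum_(0 <= i < m.+1) mu`_[i] = 1 ->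
  A 0 0 != 0 -> B 0 0 != 0 -> mu 0 0 != 0 ->
  coprimep (genpoly (a_coef A)) (genpoly mu) ->
  coprimep (genpoly B) (genpoly (nu_coef mu)) ->
  posdef Ga -> posdef GB -> pos_def_conditions A B mu alpha beta Ga GB ->
  feasible A B mu alpha beta.
Proof.
move=> al0 be0 sB smu A0 B0 mu0 copa copB pGa pGB pd.
have lbA (z : R[i]) : alpha * cform z z ^+ m
      + (cform z z - 1) * gform Ga cform (fun i => z ^+ (m - i.+1))
    <= cform (cgenpoly mu).[z] (cgenpoly (a_coef A)).[z].
  rewrite (multiplier_identity_at mu (a_coef A) Ga) lerD2r.
  have := pos_def_form_a pd cform_psd (fun i : 'I_m.+1 => z ^+ (m - i)) pGa.1.
  by rewrite subn0 cform_exp.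
have lbB (z : R[i]) : beta * (cform z z ^+ m * cform (z - 1) (z - 1))
      + (cform z z - 1) * gform GB cform (fun i => z ^+ (m.+1 - i.+1))
    <= cform (cgenpoly (nu_coef mu)).[z] (cgenpoly B).[z].
  rewrite (multiplier_identity_at (nu_coef mu) B GB) lerD2r.
  have := pos_def_form_B pd cform_psd (fun i : 'I_m.+2 => z ^+ (m.+1 - i)) pGB.1.
  rewrite /= subn0 subSS subn0 exprS -{2 4}[z ^+ m]mul1r -mulrBl [_ * z ^+ m]mulrC.
  by rewrite cformM cform_exp.
split=> //.
- by split; apply: size_genpoly => //; rewrite mxE big_nat1 entry0.
- move=> z /rootP z0; have := lbA z; rewrite z0 (psd_form0l cform_psd) => lez.
  rewrite normc_def -[1]/((1 : R)%:C)%C ltcR ltNge; apply/negP => z1.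
  have {z1} z1 : 1 <= cform z z.
    have z2 : 0 <= cform z z by have [_ _] := cform_psd; apply.
    rewrite -[X in _ <= X]sqr_sqrtr // -[1](expr1n _ 2) lerXn2r ?nnegrE //.
  have G0 : 0 <= gform Ga cform (fun i => z ^+ (m - i.+1)).
    exact: (gform_posdef _ cform_psd pGa).
  have z2 : 0 < alpha * cform z z ^+ m by rewrite mulr_gt0 // exprn_gt0 //; lra.
  have z3 : 0 <= (cform z z - 1) * gform Ga cform (fun i => z ^+ (m - i.+1)).
    by rewrite mulr_ge0 // subr_ge0.
  by have := ltr_wpDr z3 z2; rewrite ltNge => /negP; apply.
split=> //.
have [Pa PaE] := re_product_poly (a_coef A) mu.
have [Q QE] := re_product_poly B (nu_coef mu).
have cosP x : -1 <= x < 1 -> exists2 t : R, 0 < t <= pi & cos t = x.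
  move=> x1; have x2 : -1 <= x <= 1 by case/andP: x1 => -> /ltW.
  exists (acos x); last by rewrite acosK.
  by rewrite acos_gt0 // acos_lepi.
have cos_lt1 t : 0 < t <= pi -> cos t < 1 :> R.
  move=> /andP[t0 t1]; rewrite lt_neqAle cos_le1 andbT -cos0.
  apply/eqP => /cos_inj; rewrite !in_itv /= lexx pi_ge0 t1 ltW //.
  by move=> /(_ isT isT) t2; rewrite t2 ltxx in t0.
have [PB PBE] : exists PB : {poly R}, forall t, 0 < t <= pi ->
    PB.[cos t] = re_product B (nu_coef mu) t / (2 * (1 - cos t)).
  (* nu sums to zero, hence the numerator vanishes at t = 0, that is at x = 1 *)
  have /factor_theorem[q qE] : root Q 1.
    rewrite /root -[1](@cos0 R) QE re_productE.
    have -> : expi 0 = 1 :> R[i] by rewrite /expi cos0 sin0.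
    suff -> : (cgenpoly (nu_coef mu)).[1] = 0.
      by have [_ sym _] := cform_psd; rewrite sym (psd_form0l cform_psd).
    rewrite cgenpolyE; under eq_bigr do rewrite expr1n.
    by rewrite (sum_nu_coef mu (fun=> 1 : Rcomplex R)) big1 // => i _; rewrite subrr scaler0.
  exists (- 2^-1 *: q) => t /cos_lt1 ct; rewrite -QE qE !hornerE.
  field; lra.
exists Pa, PB; split => // x.
move=> x1; split; [move: x x1|move: x x1]; apply: horner_ge_closed => x /cosP[t t0 <-].
  rewrite PaE re_productE.
  have := lbA (expi t); rewrite cform_expi expr1n subrr mul0r mulr1 addr0.
  by have [_ sym _] := cform_psd; rewrite sym.
rewrite PBE // ler_pdivlMr; last by have := cos_lt1 _ t0; lra.
rewrite re_productE; have := lbB (expi t).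
rewrite cform_expi expr1n subrr mul0r mul1r addr0.
have -> : cform (expi t - 1) (expi t - 1) = 2 * (1 - cos t).
  by rewrite /cform /= subr0 -!expr2 sin2cos2; ring.
by have [_ sym _] := cform_psd; rewrite sym.
Qed.

End unit_circle.

(** * Positive semidefiniteness of integer matrices *)

Section integer_tables.
Variable R : realType.
Local Notation ofZ := (ofZ R).

Lemma ofZ0 : ofZ 0%BZ = 0. Proof. by []. Qed.
Lemma ofZ1 : ofZ 1%BZ = 1. Proof. by []. Qed.

Lemma ofZD x y : ofZ (Z.add x y) = ofZ x + ofZ y.
Proof. by rewrite /ofZ (rmorphD int_of_Z x y) rmorphD. Qed.

Lemma ofZN x : ofZ (Z.opp x) = - ofZ x.
Proof. by rewrite /ofZ (rmorphN int_of_Z x) rmorphN. Qed.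

Lemma ofZB x y : ofZ (Z.sub x y) = ofZ x - ofZ y.
Proof. by rewrite -Z.add_opp_r ofZD ofZN. Qed.

Lemma ofZM x y : ofZ (Z.mul x y) = ofZ x * ofZ y.
Proof. by rewrite /ofZ (rmorphM int_of_Z x y) rmorphM. Qed.

Lemma ofZ_nat n : ofZ (Z.of_nat n) = n%:R.
Proof. by elim: n => [|n IH] //; rewrite Znat.Nat2Z.inj_succ ofZD IH -natr1. Qed.

Lemma ofZ_exp x n : ofZ (Z.pow x (Z.of_nat n)) = ofZ x ^+ n.
Proof.
elim: n => [|n IH] //; rewrite Znat.Nat2Z.inj_succ Z.pow_succ_r ?ofZM ?IH ?exprS //.
exact: Znat.Nat2Z.is_nonneg.
Qed.

Lemma ofZ_ge0 x : Z.leb 0 x -> 0 <= ofZ x.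
Proof. by move=> /Z.leb_spec0/Znat.Z2Nat.id <-; rewrite ofZ_nat. Qed.

Lemma ofZ_neq0 x : ~~ Z.eqb x 0 -> ofZ x != 0.
Proof.
rewrite intr_eq0 => /negP x0; apply/eqP => e; apply: x0.
by rewrite -(int_of_ZK x) e.
Qed.

Lemma ofZ_gt0 x : Z.ltb 0 x -> 0 < ofZ x.
Proof.
move=> x0; rewrite lt_def ofZ_ge0 ?ofZ_neq0 //.
  by apply/negP => /Z.eqb_spec x1; rewrite x1 in x0.
by move/Z.ltb_spec0/Z.lt_le_incl/Z.leb_spec0: x0.
Qed.

Lemma ofZ_abs x : ofZ (Z.abs x) = `|ofZ x|.
Proof.
have [x0|x0] := Z.abs_spec x; case: x0 => x0 ->.
  by rewrite ger0_norm // ofZ_ge0 //; apply/Z.leb_spec0.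
rewrite ofZN ler0_norm // -oppr_ge0 -ofZN ofZ_ge0 //; apply/Z.leb_spec0.
by apply/Z.opp_nonneg_nonpos/Z.lt_le_incl.
Qed.

(** A sum that reduces by computation, unlike [bigop], which is locked. *)
Definition sumZ (a b : nat) (f : nat -> Z) : Z :=
  foldr (fun i s => Z.add (f i) s) 0%BZ (index_iota a b).

Lemma ofZ_sum a b f : ofZ (sumZ a b f) = \sum_(a <= i < b) ofZ (f i).
Proof.
rewrite /sumZ unlock /reducebig; elim: (index_iota a b) => //= i s IH.
by rewrite ofZD IH.
Qed.

Definition entZ (M : seq (seq Z)) i j : Z := nth Z0 (nth [::] M i) j.

(** Tabulating makes each elimination step evaluate the entries only once. *)
Definition tabZ n (f : nat -> nat -> Z) : seq (seq Z) :=
  mkseq (fun i => mkseq (f i) n) n.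

Lemma mx_of_tabZ n f :
  mx_of_rows R n (tabZ n f) = \matrix_(i, j) ofZ (f i j).
Proof. by apply/matrixP => i j; rewrite !mxE !nth_mkseq. Qed.

Definition schurZ n (M : seq (seq Z)) : seq (seq Z) :=
  tabZ n (fun i j => Z.sub (Z.mul (entZ M 0 0) (entZ M i.+1 j.+1))
                           (Z.mul (entZ M 0 i.+1) (entZ M 0 j.+1))).

(** All pivots must be positive except the last one, which may vanish: this
    covers a singular matrix whose kernel is spanned by a vector with nonzero
    last entry, such as the constant vector for U_B minus beta (y_1 - y_2)^2. *)
Fixpoint eliminationZ n (M : seq (seq Z)) : bool :=
  match n with
  | 0 => true
  | 1 => Z.leb 0 (entZ M 0 0)
  | n'.+1 => Z.ltb 0 (entZ M 0 0) && eliminationZ n' (schurZ n' M)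
  end.

Definition psdZ n (M : seq (seq Z)) : bool :=
  all (fun i => all (fun j => Z.eqb (entZ M i j) (entZ M j i)) (iota 0 n))
      (iota 0 n)
  && eliminationZ n M.

Lemma mx_of_schurZ n M :
  mx_of_rows R n (schurZ n M) = schur (mx_of_rows R n.+1 M).
Proof.
by rewrite mx_of_tabZ; apply/matrixP => i j; rewrite !mxE ofZB !ofZM.
Qed.

Lemma psdZ_sound n M : psdZ n M -> forall t, 0 <= qform (mx_of_rows R n M) t.
Proof.
move=> /andP[/allP sM]; have Ms : (mx_of_rows R n M)^T = mx_of_rows R n M.
  apply/matrixP => i j; rewrite !mxE; congr (ofZ _).
  have /sM/allP/(_ (i : nat)) : (j : nat) \in iota 0 n by rewrite mem_iota /= add0n.
  by rewrite mem_iota /= add0n ltn_ord => /(_ isT)/Z.eqb_spec.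
elim: n M {sM} Ms => [|n IH] M Ms elM t.
  by rewrite qformE /gform big_ord0.
have {elM} [[n0 d0]|[d0 elM]] : (n = 0%N /\ Z.leb 0 (entZ M 0 0) \/
    Z.ltb 0 (entZ M 0 0) /\ eliminationZ n (schurZ n M)).
  by case: n elM {IH Ms t} => [|n] /=; [left|right; apply/andP].
  rewrite {}n0 in t *; rewrite qformE /gform !big_ord1 mxE.
  by rewrite mulr_ge0 ?ofZ_ge0 // sqr_ge0.
rewrite -(pmulr_rge0 _ (ofZ_gt0 d0)) qformE.
have := gform_schur (@psd_form_mul R) (fun i => t i 0) Ms.
rewrite {1}mxE => ->; rewrite addr_ge0 ?sqr_ge0 // -mx_of_schurZ.
have := IH _ _ elM (\col_i t (lift ord0 i) 0); rewrite qformE.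
rewrite mx_of_schurZ schur_sym // => /(_ erefl).
congr (0 <= gform _ _ _); apply: funext => i; by rewrite mxE.
Qed.

Definition colZ r (l : seq Z) : 'cV[R]_r := \col_i ofZ (nth Z0 l i).

Lemma scaled_entry r c l i : (i < r.+1)%N ->
  (c *: colZ r.+1 l)`_[i] = c * ofZ (nth Z0 l i).
Proof. by move=> ir; rewrite (entryE _ (Ordinal ir)) !mxE. Qed.

(** Numerators of U_mx over the common denominator 2 cp cq cg. *)
Definition U_tabZ m (cp cq cg : Z) (p q : seq Z) (G : seq (seq Z)) i j : Z :=
  Z.add
   (Z.mul cg (Z.add (Z.mul (nth Z0 p i) (nth Z0 q j))
                    (Z.mul (nth Z0 q i) (nth Z0 p j))))
   (Z.mul (Z.mul 2 (Z.mul cp cq))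
      (Z.sub (if (0 < i)%N && (0 < j)%N then entZ G i.-1 j.-1 else 0%BZ)
             (if (i < m)%N && (j < m)%N then entZ G i j else 0%BZ))).

Lemma U_mx_tabZ m cp cq cg (p q : seq Z) (G : seq (seq Z)) :
  ofZ cp != 0 -> ofZ cq != 0 -> ofZ cg != 0 ->
  (2 * ofZ cp * ofZ cq * ofZ cg) *:
    U_mx ((ofZ cp)^-1 *: colZ m.+1 p) ((ofZ cq)^-1 *: colZ m.+1 q)
         ((ofZ cg)^-1 *: mx_of_rows R m G)
  = \matrix_(i, j) ofZ (U_tabZ m cp cq cg p q G i j).
Proof.
move=> cp0 cq0 cg0; apply/matrixP => i j; rewrite /U_mx 2!mxE.
rewrite [X in _ * (_ + X)](shift_cornersE (g := fun i j => (ofZ cg)^-1 * ofZ (entZ G i j))).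
  rewrite !mxE !big_ord1 !mxE /U_tabZ !(ofZD, ofZM, ofZB).
  have -> : ofZ 2%BZ = 2 by rewrite -(ofZ_nat 2).
  by case: ifP => _; case: ifP => _; rewrite ?ofZ0; field; rewrite ?cp0 ?cq0 ?cg0.
by move=> a b; rewrite !mxE.
Qed.

Lemma U_mx_lower m cp cq cg (p q l : seq Z) (G : seq (seq Z)) (c : R) w :
  Z.ltb 0 cp -> Z.ltb 0 cq -> Z.ltb 0 cg ->
  (2 * ofZ cp * ofZ cq * ofZ cg) * c = ofZ w ->
  psdZ m.+1 (tabZ m.+1 (fun i j => Z.sub (U_tabZ m cp cq cg p q G i j)
                                  (Z.mul w (Z.mul (nth Z0 l i) (nth Z0 l j))))) ->
  forall t : 'cV[R]_m.+1, c * (\sum_(i < m.+1) ofZ (nth Z0 l i) * t i 0) ^+ 2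
    <= qform (U_mx ((ofZ cp)^-1 *: colZ m.+1 p) ((ofZ cq)^-1 *: colZ m.+1 q)
         ((ofZ cg)^-1 *: mx_of_rows R m G)) t.
Proof.
move=> /ofZ_gt0 cp0 /ofZ_gt0 cq0 /ofZ_gt0 cg0 cw /psdZ_sound psd t.
have D0 : 0 < 2 * ofZ cp * ofZ cq * ofZ cg by rewrite !mulr_gt0.
rewrite -subr_ge0 -(pmulr_rge0 _ D0) mulrBr mulrA cw !qformE -gformZ.
rewrite U_mx_tabZ ?gt_eqF //; have := psd t.
rewrite qformE mx_of_tabZ; congr (0 <= _).
have -> : \sum_(i < m.+1) ofZ (nth Z0 l i) * t i 0 = \sum_i colZ m.+1 l i 0 *: (t i 0 : R^o).
  by apply: eq_bigr => i _; rewrite mxE.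
rewrite expr2 (psd_form_lin (@psd_form_mul R)) -mulNr -gformZ -gformD.
congr (gform _ _ _); apply/matrixP => i j.
by rewrite !mxE big_ord1 !mxE ofZB !ofZM mulNr.
Qed.

(** The identity matrix is subtracted first: a test of semidefiniteness then
    gives strict positivity. *)
Lemma posdefZ m cg (G : seq (seq Z)) : Z.ltb 0 cg ->
  psdZ m (tabZ m (fun i j => Z.sub (entZ G i j) (if i == j then 1 else 0)%BZ)) ->
  posdef ((ofZ cg)^-1 *: mx_of_rows R m G).
Proof.
move=> /ofZ_gt0 cg0 psdG.
have Gs i j : (i < m)%N -> (j < m)%N -> entZ G i j = entZ G j i.
  move=> im jm; case/andP: psdG => /allP/(_ i); rewrite mem_iota im => /(_ isT)/allP/(_ j).
  rewrite mem_iota jm => /(_ isT)/Z.eqb_spec + _; rewrite /entZ !nth_mkseq //.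
  by rewrite eq_sym; case: eqP => _; lia.
split=> [|x x0].
  by apply/matrixP => i j; rewrite !mxE -/(entZ G j i) Gs.
rewrite qformE gformZ mulr_gt0 ?invr_gt0 //.
have -> : mx_of_rows R m G = mx_of_rows R m (tabZ m (fun i j => Z.sub (entZ G i j) (if i == j then 1 else 0)%BZ)) + 1%:M.
  apply/matrixP => i j; rewrite mx_of_tabZ !mxE ofZB -/(entZ G i j).
  by rewrite -val_eqE /=; case: eqP => _; rewrite ?ofZ0 ?ofZ1 ?subrK ?subr0 ?addr0.
rewrite gformD -qformE ltr_wpDl ?psdZ_sound // gform_scalar mul1r.
exact: sum_sqr_gt0.
Qed.

End integer_tables.

(** * Coprimality of integer polynomials *)

Section euclid.
Variable R : realType.
Local Notation ofZ := (ofZ R).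

(** Coefficients are listed from the highest degree down, as in the generating
    polynomials. *)
Fixpoint hpolyZ (l : seq Z) : {poly R} :=
  if l is a :: l' then ofZ a *: 'X^(size l') + hpolyZ l' else 0.

(** b p - a X^k q with k the difference of the lengths, for p at least as long
    as q. *)
Fixpoint combineZ (b : Z) (p : seq Z) (a : Z) (q : seq Z) : seq Z :=
  match p, q with
  | x :: p', y :: q' => Z.sub (Z.mul b x) (Z.mul a y) :: combineZ b p' a q'
  | x :: p', [::] => Z.mul b x :: combineZ b p' a [::]
  | [::], _ => [::]
  end.

(** The Euclidean algorithm, one cancellation of leading terms at a time and
    without division.  The fuel bounds the number of steps. *)
Fixpoint coprimeZ (fuel : nat) (p q : seq Z) : bool :=
  match fuel, p, q with
  | fuel'.+1, a :: p', b :: q' =>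
      if q' is [::] then ~~ Z.eqb b 0
      else if (size q' <= size p')%N then coprimeZ fuel' (combineZ b p' a q') q
      else coprimeZ fuel' q p
  | _, _, _ => false
  end.

Lemma size_combineZ b p a q : size (combineZ b p a q) = size p.
Proof. by elim: p q => [|x p IH] [|y q] //=; rewrite IH. Qed.

Lemma hpoly_combineZ b p a q : (size q <= size p)%N ->
  hpolyZ (combineZ b p a q)
  = ofZ b *: hpolyZ p - ofZ a *: ('X^(size p - size q) * hpolyZ q).
Proof.
elim: p q => [|x p IH] [|y q] //= qp.
- by rewrite mulr0 !scaler0 subrr.
- by rewrite IH //= !mulr0 !scaler0 !subr0 size_combineZ ofZM scalerDr scalerA.
- rewrite IH // subSS size_combineZ ofZB !ofZM scalerBl !scalerDr mulrDr.
  rewrite scalerDr -!scalerA -scalerAr -exprD subnK // opprD !addrA.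
  by congr (_ - _); rewrite addrAC.
Qed.

(** A common divisor of p and q divides every combination of them, hence all
    the remainders. *)
Lemma coprimeZ_sound fuel p q :
  coprimeZ fuel p q -> coprimep (hpolyZ p) (hpolyZ q).
Proof.
elim: fuel p q => [|fuel IH] // [|a p] [|b [|b' q]] //.
  move=> /(ofZ_neq0 R) b0; rewrite [hpolyZ [:: b]]/= expr0 addr0.
  by rewrite coprimepZr ?coprimep1.
move: (b' :: q) (isT : b' :: q != [::]) => {b' q} q' q'0.
rewrite [coprimeZ _ _ _](_ : _ = if (size q' <= size p)%N
  then coprimeZ fuel (combineZ b p a q') (b :: q')
  else coprimeZ fuel (b :: q') (a :: p)); last by case: q' q'0.
case: ifP => qp; last first.
  by move/IH; rewrite coprimep_sym.
move=> /IH; rewrite hpoly_combineZ // => cop; apply/coprimepP => d dp dq.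
have /coprimepP := cop; apply=> //.
have -> : ofZ b *: hpolyZ p - ofZ a *: ('X^(size p - size q') * hpolyZ q') =
   ofZ b *: hpolyZ (a :: p) - ofZ a *: ('X^(size p - size q') * hpolyZ (b :: q')).
  rewrite [hpolyZ (a :: p)]/= [hpolyZ (b :: q')]/=.
  rewrite mulrDr !scalerDr -scalerAr -exprD subnK // !scalerA [ofZ a * _]mulrC.
  by rewrite opprD addrACA subrr add0r.
by rewrite dvdp_sub // -mul_polyC dvdp_mull // dvdp_mull.
Qed.

Lemma genpoly_colZ c r l : size l = r.+1 ->
  genpoly (c *: colZ R r.+1 l) = c *: hpolyZ l.
Proof.
move=> sl; rewrite /genpoly.
transitivity (\sum_(0 <= i < size l) (c * ofZ (nth Z0 l i)) *: ('X^((size l).-1 - i) : {poly R})).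
  rewrite sl !big_mkord; apply: eq_bigr => i _.
  by rewrite scaled_entry.
elim: l {sl} => [|a l IH]; first by rewrite big_nil scaler0.
rewrite big_nat_recl //= subn0 scalerDr scalerA; congr (_ + _).
rewrite -IH; apply: eq_big_nat => i /andP[_ il].
by rewrite -subn1 subnAC subn1 -subnS.
Qed.

Lemma coprime_genpolyZ fuel c c' r r' l l' : c != 0 -> c' != 0 ->
  size l = r.+1 -> size l' = r'.+1 -> coprimeZ fuel l l' ->
  coprimep (genpoly (c *: colZ R r.+1 l)) (genpoly (c' *: colZ R r'.+1 l')).
Proof.
move=> c0 c'0 sl sl' /coprimeZ_sound; rewrite !genpoly_colZ //.
by rewrite coprimepZl // coprimepZr.
Qed.

End euclid.

(** * The coefficients of WSBDF7 *)

Section wsbdf7_checks.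
Variable R : realType.
Local Notation ofZ := (ofZ R).

(** Numerators of the coefficients, over 420 for A and its partial sums a, over
    5 for mu and nu, and over 1 for the other vectors. *)
Definition A_num : seq Z :=
  [:: 3147; -10038; 15750; -16800; 12425; -5922; 1638; -200]%BZ.
Definition a_num : seq Z :=
  [:: 3147; -6891; 8859; -7941; 4484; -1438; 200]%BZ.
Definition B_num : seq Z := [:: 3; -2; 0; 0; 0; 0; 0; 0]%BZ.
Definition Bh_num : seq Z := [:: 19; -63; 105; -105; 63; -21; 3]%BZ.
Definition mu_num : seq Z := [:: 20; -21; 3; 12; -16; 11; -4]%BZ.
Definition nu_num : seq Z := [:: 20; -41; 24; 9; -28; 27; -15; 4]%BZ.

Lemma ofZ_num (z : Z) :
  ofZ z = if Z.leb 0 z then (Z.to_nat z)%:R else - (Z.to_nat (Z.opp z))%:R.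
Proof.
case: ifP => [/Z.leb_spec0|/Z.leb_spec0/Z.nle_gt/Z.lt_le_incl] z0.
  by rewrite -(ofZ_nat R) Znat.Z2Nat.id.
by rewrite -(ofZ_nat R) Znat.Z2Nat.id ?ofZN ?opprK //; exact/Z.opp_nonneg_nonpos.
Qed.

Lemma wsbdf7_AE : wsbdf7_A R = (ofZ 420)^-1 *: colZ R 8 A_num.
Proof.
apply/matrixP => i j; rewrite !mxE.
have e420 : ofZ 420%BZ = 420 by rewrite ofZ_num.
rewrite e420.
case: i => -[|[|[|[|[|[|[|[|//]]]]]]]] im /=; rewrite ofZ_num /=;
  (* field recognizes unary numerals, but not Pos.to_nat *)
  match goal with |- context [PosDef.Pos.to_nat ?p] =>
    let v := eval vm_compute in (PosDef.Pos.to_nat p) in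
    change (PosDef.Pos.to_nat p) with v
  end; by field.
Qed.

Lemma wsbdf7_BE : wsbdf7_B R = (ofZ 1)^-1 *: colZ R 8 B_num.
Proof.
apply/matrixP => i j; rewrite !mxE ofZ1 invr1 mul1r.
by case: i => -[|[|[|[|[|[|[|[|//]]]]]]]] im; rewrite ofZ_num.
Qed.

Lemma wsbdf7_BhE : wsbdf7_Bh R = (ofZ 1)^-1 *: colZ R 7 Bh_num.
Proof.
apply/matrixP => i j; rewrite !mxE ofZ1 invr1 mul1r.
by case: i => -[|[|[|[|[|[|[|//]]]]]]] im; rewrite ofZ_num.
Qed.

Lemma wsbdf7_muE : wsbdf7_mu R = (ofZ 5)^-1 *: colZ R 7 mu_num.
Proof.
apply/matrixP => i j; rewrite !mxE.
rewrite (_ : ofZ 5 = 5); last by rewrite ofZ_num.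
by case: i => -[|[|[|[|[|[|[|//]]]]]]] im; rewrite ofZ_num.
Qed.

Lemma wsbdf7_aE : a_coef (wsbdf7_A R) = (ofZ 420)^-1 *: colZ R 7 a_num.
Proof.
apply/matrixP => i j; rewrite wsbdf7_AE !mxE.
rewrite big_mkord; under eq_bigr => k _.
  rewrite scaled_entry; last exact: leq_trans (ltn_ord k) (leqW (ltn_ord i)).
  over.
rewrite -mulr_sumr -(big_mkord xpredT (fun k => ofZ (nth Z0 A_num k))) -ofZ_sum.
congr (_ * ofZ _).
by case: i => -[|[|[|[|[|[|[|//]]]]]]].
Qed.

Lemma wsbdf7_nuE : nu_coef (wsbdf7_mu R) = (ofZ 5)^-1 *: colZ R 8 nu_num.
Proof.
apply/matrixP => i j; rewrite ord1 wsbdf7_muE nu_coefE !mxE.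
by case: i => -[|[|[|[|[|[|[|[|//]]]]]]]] im; rewrite /= ?scaled_entry //=
  -?mulrBr ?sub0r ?subr0 -?mulrN -?ofZB -?ofZN.
Qed.

Lemma wsbdf7_order :
  order_conditions (wsbdf7_A R) (wsbdf7_B R) (wsbdf7_Bh R).
Proof.
rewrite wsbdf7_AE wsbdf7_BE wsbdf7_BhE.
have moment c r l q : \sum_(0 <= i < r.+1) (c *: colZ R r.+1 l)`_[i] * (- i%:R) ^+ q
   = c * ofZ (sumZ 0 r.+1 (fun i => Z.mul (nth Z0 l i)
                (Z.pow (Z.opp (Z.of_nat i)) (Z.of_nat q)))).
  rewrite ofZ_sum mulr_sumr; apply: eq_big_nat => i /andP[_ ir].
  by rewrite scaled_entry // ofZM ofZ_exp ofZN ofZ_nat mulrA.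
have moment1 c r l q : \sum_(1 <= i < r.+2) (c *: colZ R r.+1 l)`_[i.-1] * (- i%:R) ^+ q
   = c * ofZ (sumZ 1 r.+2 (fun i => Z.mul (nth Z0 l i.-1)
                (Z.pow (Z.opp (Z.of_nat i)) (Z.of_nat q)))).
  rewrite ofZ_sum mulr_sumr; apply: eq_big_nat => i /andP[i0 ir].
  by rewrite scaled_entry ?prednK // ofZM ofZ_exp ofZN ofZ_nat mulrA.
have sum_moment c r l : \sum_(0 <= i < r.+1) (c *: colZ R r.+1 l)`_[i] =
   \sum_(0 <= i < r.+1) (c *: colZ R r.+1 l)`_[i] * (- i%:R) ^+ 0.
  by apply: eq_bigr => i _; rewrite mulr1.
have e420 : ofZ 420 != 0 by exact: ofZ_neq0.
split.
- by rewrite sum_moment moment (_ : sumZ _ _ _ = 0%BZ) ?ofZ0 ?mulr0.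
- move=> q q6; rewrite !moment moment1 ofZ1 invr1 !mul1r -(ofZ_nat R q.+1).
  split; last first.
    rewrite -!ofZM; congr ofZ.
    by do 7?[case: q q6 => [|q] q6; first by vm_compute].
  apply: (mulfI e420); rewrite mulVKf // -!ofZM; congr ofZ.
  by do 7?[case: q q6 => [|q] q6; first by vm_compute].
- under eq_bigr do rewrite -[- _]expr1.
  rewrite moment (_ : sumZ _ _ _ = 420%BZ) ?mulVf //; exact: ofZ_neq0.
- by rewrite sum_moment moment ofZ1 invr1 mul1r.
- under eq_bigr do rewrite -[_`_[_]]mulr1.
  by rewrite (moment1 _ _ _ 0%N) ofZ1 invr1 mul1r.
Qed.

Lemma wsbdf7_mu_sum : \sum_(0 <= i < 7) (wsbdf7_mu R)`_[i] = 1.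
Proof.
rewrite wsbdf7_muE (eq_big_nat _ _ (F2 := fun i => (ofZ 5)^-1 * ofZ (nth Z0 mu_num i))).
  by rewrite -mulr_sumr -ofZ_sum (_ : sumZ _ _ _ = 5%BZ) // mulVf // ofZ_neq0.
by move=> i /andP[_ i7]; rewrite scaled_entry.
Qed.

(** Every c~_i is an integer over 5. *)
Lemma wsbdf7_chat :
  chat (wsbdf7_Bh R) (wsbdf7_mu R) 0 = ofZ 33856 / 5.
Proof.
rewrite wsbdf7_BhE wsbdf7_muE.
set Bh := _ *: colZ R 7 Bh_num; set mu := _ *: colZ R 7 mu_num.
pose muZ i := Z.abs (nth Z0 mu_num i).
pose bhatZ i := Z.sub (sumZ 1 i.+1 (fun j => nth Z0 Bh_num j.-1)) 1.
have muE i : (i < 7)%N -> 5 * `|mu`_[i]| = ofZ (muZ i).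
  move=> i7; rewrite scaled_entry // normrM normfV -ofZ_abs.
  by rewrite mulrA (_ : ofZ (Z.abs 5) = 5) ?divff ?mul1r -?ofZ_abs // ofZ_num.
have bhatE i : (i < 7)%N -> `|bhat Bh i| = ofZ (Z.abs (bhatZ i)).
  move=> i7; rewrite ofZ_abs ofZB ofZ_sum; congr `|_ - _|.
  apply: eq_big_nat => j /andP[j0 ji].
  have j7 : (j.-1 < 7)%N by rewrite prednK // (leq_trans _ (ltnW i7)).
  by rewrite scaled_entry // ofZ1 invr1 mul1r.
pose ctildeZ i : Z := Z.add (Z.add (Z.add
   (Z.mul (Z.mul (if i == 0%N then 0 else 1)%BZ (Z.abs (bhatZ i))) (sumZ 0 7 muZ))
   (Z.mul (muZ i) (sumZ 1 7 (fun j => Z.abs (bhatZ j)))))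
   (muZ i))
   (Z.mul (Z.add (muZ i) (sumZ i 7 (fun j => Z.mul (Z.of_nat j) (muZ j))))
     (if i == 0%N then 0 else 1)%BZ).
have ctildeE i : (i < 7)%N -> 5 * ctilde Bh mu i = ofZ (ctildeZ i).
  have sum_mu a : 5 * \sum_(a <= j < 7) `|mu`_[j]| = ofZ (sumZ a 7 muZ).
    rewrite ofZ_sum mulr_sumr.
    by apply: eq_big_nat => j /andP[_ j7]; rewrite muE.
  have sum_jmu a : 5 * \sum_(a <= j < 7) j%:R * `|mu`_[j]|
      = ofZ (sumZ a 7 (fun j => Z.mul (Z.of_nat j) (muZ j))).
    rewrite ofZ_sum mulr_sumr; apply: eq_big_nat => j /andP[_ j7].
    by rewrite ofZM -muE // ofZ_nat mulrCA.
  have sum_bhat : \sum_(1 <= j < 7) `|bhat Bh j|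
      = ofZ (sumZ 1 7 (fun j => Z.abs (bhatZ j))).
    rewrite ofZ_sum; apply: eq_big_nat => j /andP[_ j7]; exact: bhatE.
  have ind : ofZ (if i == 0%N then 0 else 1)%BZ = 1 - (i == 0%N)%:R.
    by case: eqP => _; rewrite ?ofZ0 ?ofZ1 ?subrr ?subr0.
  move=> i7; rewrite /ctilde /ctildeZ.
  move: (sum_mu 0%N) (sum_jmu i) sum_bhat.
  move: (sumZ 0 7 _) (sumZ i 7 _) (sumZ 1 7 _) => s1 s2 s3 e1 e2 ->.
  rewrite !(ofZD, ofZM) -e1 -e2 ind -muE // -bhatE //; ring.
rewrite /chat; apply: (mulfI (_ : 5 != 0 :> R)) => //.
rewrite mulr_sumr mulrCA divff // mulr1.
transitivity (\sum_(0 <= j < 7) ofZ (ctildeZ j)).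
  by apply: eq_big_nat => j /andP[_ j7]; rewrite ctildeE.
by rewrite -ofZ_sum.
Qed.

Lemma wsbdf7_posdef : posdef (wsbdf7_Ga R) /\ posdef (wsbdf7_GB R).
Proof.
split.
  by apply: posdefZ; [|vm_compute].
by apply: posdefZ; [|vm_compute].
Qed.

Lemma wsbdf7_pos_def_conditions :
  pos_def_conditions (wsbdf7_A R) (wsbdf7_B R) (wsbdf7_mu R) (1 / 4) (1 / 100)
    (wsbdf7_Ga R) (wsbdf7_GB R).
Proof.
have n2 : 2 = ofZ 2 by rewrite ofZ_num.
have n4 : 4 = ofZ 4 by rewrite ofZ_num.
have n100 : 100 = ofZ 100 by rewrite ofZ_num.
split=> [x|y].
  have -> : x`_[0] = \sum_(i < 7) ofZ (nth Z0 [:: 1%BZ] i) * x i 0.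
    rewrite entry0 big_ord_recl big1 => [|i _]; last by rewrite lift0 nth_default ?mul0r.
    by rewrite ofZ1 mul1r addr0.
  (* 105000 is alpha = 1/4 times the denominator 2 * 5 * 420 * 100 *)
  rewrite wsbdf7_aE wsbdf7_muE; apply: (U_mx_lower (w := 105000%BZ));
    [by []|by []|by []| |by vm_compute].
    rewrite n2 n4 -!ofZM mul1r.
    by apply: (canLR (mulfK _)); [exact: ofZ_neq0|rewrite -ofZM].
have -> : y`_[0] - y`_[1] = \sum_(i < 8) ofZ (nth Z0 [:: 1; -1]%BZ i) * y i 0.
  rewrite entry0 (entryE y (lift ord0 ord0)) big_ord_recl big_ord_recl.
  rewrite big1 => [|i _]; last by rewrite !lift0 nth_default ?mul0r.
  by rewrite /= ofZ1 mul1r addr0 (ofZN R 1) ofZ1 mulN1r.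
(* 1000 is beta = 1/100 times the denominator 2 * 5 * 1 * 10000 *)
rewrite wsbdf7_nuE wsbdf7_BE; apply: (U_mx_lower (w := 1000%BZ));
  [by []|by []|by []| |by vm_compute].
  rewrite n2 n100 -!ofZM mul1r.
  by apply: (canLR (mulfK _)); [exact: ofZ_neq0|rewrite -ofZM].
Qed.

Lemma wsbdf7_coprime :
  coprimep (genpoly (a_coef (wsbdf7_A R))) (genpoly (wsbdf7_mu R))
  /\ coprimep (genpoly (wsbdf7_B R)) (genpoly (nu_coef (wsbdf7_mu R))).
Proof.
rewrite wsbdf7_nuE wsbdf7_aE wsbdf7_BE wsbdf7_muE.
by split; apply: (@coprime_genpolyZ _ 30);
  rewrite ?invr_neq0 ?ofZ_neq0 //; vm_compute.
Qed.

End wsbdf7_checks.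

(** * Riesz representation *)

Section psd_inequalities.
Variables (R : realType) (V : lmodType R) (K : V -> V -> R).
Hypothesis Kpsd : psd_form K.

Lemma psd_formNl x y : K (- x) y = - K x y.
Proof. by rewrite -scaleN1r psd_formZl // mulN1r. Qed.

Lemma psd_formNr x y : K x (- y) = - K x y.
Proof. by rewrite -scaleN1r psd_formZr // mulN1r. Qed.

Lemma psd_form_young x y : `|K x y| <= (K x x + K y y) / 2.
Proof.
have [_ sym ge0] := Kpsd.
have := ge0 (x + y); have := ge0 (x - y).
rewrite !(psd_formDl Kpsd) !(psd_formDr Kpsd) !psd_formNl !psd_formNr (sym y x).
by rewrite ler_norml => h1 h2; apply/andP; split; lra.
Qed.

End psd_inequalities.

Section riesz.
Variables (R : realType) (V : completeNormedModType R).
Variables (a : V -> V -> R) (phi : V -> R) (c C : R).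
Hypothesis a_psd : psd_form a.
Hypothesis a_continuous : forall w, continuous (fun v => a v w : R^o).
Hypotheses (c_gt0 : 0 < c) (a_coercive : forall v, c * `|v| ^+ 2 <= a v v).
Hypothesis phi_linear : linear (phi : V -> R^o).
Hypothesis phi_bounded : forall v, `|phi v| <= C * `|v|.

Let J v := a v v - 2 * phi v.

Let phiE t v w : phi (t *: v + w) = t * phi v + phi w.
Proof. exact: phi_linear. Qed.

Let JD t v w : J (v + t *: w) = J v + 2 * t * (a v w - phi w) + t ^+ 2 * a w w.
Proof.
have [_ sym _] := a_psd.
have -> : J (v + t *: w) =
    a (v + t *: w) (v + t *: w) - 2 * (t * phi w + phi v).
  by rewrite -phiE addrC.
rewrite /J !(psd_formDl a_psd) !(psd_formDr a_psd).
rewrite !(psd_formZl a_psd) !(psd_formZr a_psd) (sym w v); ring.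
Qed.

(** J is the quadratic functional whose minimizer solves the problem; coercivity
    bounds it from below. *)
Lemma riesz_minimizing : exists (v : nat -> V) (m : R),
  (forall w, m <= J w) /\ forall n, J (v n) < m + n.+1%:R^-1.
Proof.
have J_lb w : - (C ^+ 2 / c) <= J w.
  have h1 := a_coercive w; have := phi_bounded w; rewrite ler_norml => /andP[_ h2].
  have : 0 <= (c * `|w| - C) ^+ 2 / c by rewrite divr_ge0 ?sqr_ge0 // ltW.
  have -> : (c * `|w| - C) ^+ 2 / c = c * `|w| ^+ 2 - 2 * (C * `|w|) + C ^+ 2 / c.
    by field; rewrite gt_eqF.
  rewrite /J; lra.
have hinf : has_inf (range J).
  by split; [exists (J 0), 0|exists (- (C ^+ 2 / c)) => _ [w _ <-]].
have /choice[v vE] n : exists v, J v < inf (range J) + n.+1%:R^-1.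
  by have [//|_ [v _ <-] lt] := @inf_adherent _ _ n.+1%:R^-1 _ hinf; exists v.
exists v, (inf (range J)); split=> // w.
by apply: ge_inf; [exact: hinf.2|exists w].
Qed.

(** By the parallelogram law a minimizing sequence is Cauchy.  Near the infimum
    of J the residual a(v_n, w) - phi(w) tends to 0 for each w, as otherwise a
    step in the direction w would decrease J below the infimum. *)
Lemma riesz_representation : exists v, forall w, a v w = phi w.
Proof.
have [_ sym a_ge0] := a_psd.
have [v [m [mJ Jv]]] := riesz_minimizing.
have v_cauchy n k : c * `|v n - v k| ^+ 2 <= 2 * (n.+1%:R^-1 + k.+1%:R^-1).
  apply: le_trans (a_coercive _) _.
  have -> : a (v n - v k) (v n - v k) = a (v k - v n) (v k - v n).
    by rewrite -opprB (psd_formNl a_psd) (psd_formNr a_psd) opprK.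
  have := mJ (v n + 2^-1 *: (v k - v n)).
  have := JD 1 (v n) (v k - v n); rewrite scale1r (addrC (v n) (v k - v n)) subrK JD.
  have e1 : 2 * 2^-1 = 1 :> R by field.
  have e2 : 2^-1 ^+ 2 = 4^-1 :> R by field.
  rewrite expr1n e1 e2; have := Jv n; have := Jv k.
  set q := a _ (_ - _); set en := n.+1%:R^-1; set ek := k.+1%:R^-1; lra.
have v_cvg : cvgn v.
  apply: cauchy_cvg; apply/cauchy_ballP => e e0; near_simpl.
  have h0 : 0 < c * e ^+ 2 / 4 by rewrite divr_gt0 ?mulr_gt0 ?exprn_gt0.
  have [N hN] : exists N, forall n, (N <= n)%N -> n.+1%:R^-1 < c * e ^+ 2 / 4.
    have /cvgr_lt/(_ _ h0) [N _ hN] := @cvg_harmonic R.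
    by exists N => n /hN.
  exists ([set n | N <= n], [set n | N <= n])%N; first by split; exists N.
  move=> [n k] [/= /hN hn /hN hk].
  rewrite -ball_normE /= -(ltr_pXn2r (n := 2)) ?nnegrE ?(ltW e0) //.
  rewrite -(ltr_pM2l c_gt0); apply: le_lt_trans (v_cauchy n k) _.
  have aux (x y z : R) : x < z / 4 -> y < z / 4 -> 2 * (x + y) < z by lra.
  exact: aux hn hk.
exists (lim (v @ \oo)) => w.
have lim_a : a (v n) w @[n --> \oo] --> (a (lim (v @ \oo)) w : R^o).
  exact: (cvg_comp _ _ v_cvg (@a_continuous w _)).
suff lim_phi : a (v n) w @[n --> \oo] --> (phi w : R^o).
  exact: (cvg_unique (@Rhausdorff R) lim_a lim_phi).
set A := a w w; have A0 : 0 <= A by exact: a_ge0.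
have bound n : (a (v n) w - phi w) ^+ 2 <= (A + 1) * n.+1%:R^-1.
  (* A + 1 instead of the optimal A, which may be zero *)
  set r := _ - _; have := mJ (v n + - (r / (A + 1)) *: w); rewrite JD -/r -/A.
  have := Jv n; set e := n.+1%:R^-1; set j := J _ => h1 h2.
  have h3 : 0 <= j + 2 * (- (r / (A + 1))) * r + (- (r / (A + 1))) ^+ 2 * A - m.
    by rewrite subr_ge0.
  have A1 : 0 < A + 1 by lra.
  have h4 : r ^+ 2 / (A + 1) <= j - m.
    have : r ^+ 2 / (A + 1) <= r ^+ 2 / (A + 1) + r ^+ 2 / (A + 1) ^+ 2.
      by rewrite lerDl divr_ge0 ?sqr_ge0.
    move/le_trans; apply; rewrite -subr_ge0; congr (0 <= _): h3.
    by field; rewrite gt_eqF.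
  by rewrite mulrC -ler_pdivrMr //; lra.
have lim0 : (A + 1) * n.+1%:R^-1 @[n --> \oo] --> (0 : R^o).
  rewrite -(mulr0 (A + 1)); apply: cvgM; first exact: cvg_cst.
  exact: cvg_harmonic.
apply/cvgrPdist_lt => e e0; have e2 : 0 < e ^+ 2 by rewrite exprn_gt0.
have /cvgr_lt/(_ _ e2) [N _ hN] := lim0.
exists N => // n /hN /= hn.
have lt_e : `|a (v n) w - phi w| < e.
  rewrite -(ltr_pXn2r (n := 2)) ?nnegrE ?(ltW e0) // real_normK ?num_real //.
  exact: le_lt_trans (bound n) hn.
by rewrite distrC.
Qed.

End riesz.

(** * The forms of the gradient flow *)

Section hilbert.
Variables (R : realType) (H : hilbertType R).

Lemma inner_psd : psd_form (@inner R H).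
Proof.
split=> [a x y z|x y|x]; last by rewrite inner_norm sqr_ge0.
- by rewrite linearPl.
- by rewrite (hermC inner) expr0 mul1r.
Qed.

(** Young's inequality for the normalized vectors. *)
Lemma inner_cauchy_schwarz (x y : H) : `|inner x y| <= `|x| * `|y|.
Proof.
have [->|x0] := eqVneq x 0.
  by rewrite (psd_form0l inner_psd) !normr0 mul0r.
have [->|y0] := eqVneq y 0.
  by have [_ sym _] := inner_psd; rewrite sym (psd_form0l inner_psd) !normr0 mulr0.
have n0 (z : H) : z != 0 -> `|z| != 0 by rewrite normr_eq0.
have := psd_form_young inner_psd (`|x|^-1 *: x) (`|y|^-1 *: y).
rewrite !(psd_formZl inner_psd) !(psd_formZr inner_psd) !inner_norm.
rewrite mulrA [X in X / 2](_ : _ = 2); last by field; rewrite !n0.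
rewrite divff // normrM ger0_norm; last by rewrite mulr_ge0 // invr_ge0.
by rewrite -invfM mulrC ler_pdivrMr ?mul1r // mulr_gt0 // normr_gt0.
Qed.

End hilbert.

Section mobility.
Variables (R : realType) (d : nat) (E : gradient_flow R d).

Lemma opM_psd : psd_form (fun v w => - opM E v w).
Proof.
have [c c0 coer] := opM_coercive E.
split=> [a x y z|x y|x].
- by rewrite linearP /= mulrN -opprD.
- by rewrite opM_symmetric.
- by apply: le_trans (coer x); rewrite mulr_ge0 ?sqr_ge0 // ltW.
Qed.

Lemma iVH_bounded : exists2 C : R, 0 <= C & forall v : spV E, `|iVH E v| <= C * `|v|.
Proof.
have [_ iVHc _] := iVH_compact E.
have /linear_boundedP [M [_ hM]] := (linear_bounded_continuous (iVH E)).2 iVHc.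
exists (Num.max 0 (M + 1)) => [|v]; first by rewrite le_max lexx.
by apply: hM; rewrite lt_max ltrDl ltr01 orbT.
Qed.

(** The element chosen by [invM] is a preimage: the form of -M is continuous and
    coercive on V, and h defines a bounded functional there. *)
Lemma opM_invM (h : spH E) : opM E (invM (iHV' h)) = iHV' h.
Proof.
suff [v vh] : exists v, opM E v = iHV' h.
  by apply: (@xgetPex _ 0 [set v | opM E v = iHV' h]); exists v.
have [c c0 coer] := opM_coercive E.
have [C C0 iVHb] := iVH_bounded.
have [|||||v vh] := @riesz_representation R (spV E) _ (fun w => - iHV' h w) c (`|h| * C) opM_psd.
- move=> w v; rewrite (_ : (fun v => _) = fun v => - opM E w v); last first.
    by apply: funext => x; rewrite opM_symmetric.
  by apply: cvgN; exact: (opM_dual w).2.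
- exact: c0.
- exact: coer.
- move=> t v w.
  rewrite /iHV' linearP (psd_formDr (inner_psd _)) (psd_formZr (inner_psd _)).
  by rewrite opprD -mulrN.
- move=> v; rewrite normrN -mulrA (le_trans (inner_cauchy_schwarz _ _)) //.
  by rewrite ler_wpM2l.
by exists v; apply: funext => w; apply: oppr_inj.
Qed.

(** The inner product of H twisted by -M^-1.  It is linear in its first argument
    by definition, and symmetric because M is. *)
Definition Mform (h h' : spH E) : R := inner h (- invMH h').

Lemma MformE h h' : Mform h h' = - opM E (invM (iHV' h)) (invM (iHV' h')).
Proof.
by rewrite opM_invM /Mform (psd_formNr (inner_psd _)).
Qed.

Lemma Mform_psd : psd_form Mform.
Proof.
have [_ sym ge0] := opM_psd; have [lin _ _] := inner_psd (spH E).
split=> [a x y z|x y|x]; first exact: lin.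
- by rewrite !MformE sym.
- by rewrite MformE ge0.
Qed.

Definition Lform (u v : spS E) : R := inner (iSH u) (iVH E (opL E v)).

Lemma iSHP t (u v : spS E) : iSH (t *: u + v) = t *: iSH u + iSH v.
Proof. by rewrite /iSH !linearP. Qed.

Lemma Lform_psd : psd_form Lform.
Proof.
have [lin sym _] := inner_psd (spH E).
split=> [a x y z|x y|x].
- by rewrite /Lform iSHP lin.
- by rewrite /Lform -opL_symmetric sym.
- by rewrite /Lform sym opL_ge0.
Qed.

End mobility.

(** * Absorbing the explicit nonlinearity *)

Section young.
Variable R : realType.

Lemma weighted_amgm (x y t : R) : 0 <= x -> 0 <= y -> 0 < t < 1 ->
  x `^ t * y `^ (1 - t) <= t * x + (1 - t) * y.
Proof.
move=> x0 y0 /andP[t0 t1]; have s0 : 0 < 1 - t by rewrite subr_gt0.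
have := @conjugate_powR R _ _ t^-1 (1 - t)^-1 (powR_ge0 x t) (powR_ge0 y (1 - t)).
rewrite !invr_gt0 !invrK (addrC t) subrK -!powRrM !mulfV ?gt_eqF // !powRr1 //.
by rewrite ![_ * t]mulrC ![_ * (1 - t)]mulrC; apply.
Qed.

(** Here r, p and q are the three norms in the interpolation inequality.  By the
    weighted arithmetic-geometric inequality the right-hand side is at least
    (alpha / (tau eta)) ^ eta * (beta / (1 - eta)) ^ (1 - eta)
    * p ^ (2 eta) * q ^ (2 (1 - eta)), and the bound on tau, raised to the power
    eta, says that the constant in front is at least C zeta ^ 2.  The case
    eta = 1, where the second factor degenerates, is direct. *)
Lemma interpolation_absorb (eta zeta alpha beta tau C p q r : R) :
  0 < eta <= 1 -> 0 < zeta -> 0 < alpha -> 0 < beta -> 0 < tau -> 0 <= C ->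
  0 <= p -> 0 <= q -> 0 <= r ->
  let eb := (1 - eta) / eta in
  tau <= alpha * beta `^ eb
    / (C `^ (1 + eb) * eta * (1 - eta) `^ eb * zeta `^ (2 + 2 * eb)) ->
  r <= zeta * p `^ eta * q `^ (1 - eta) ->
  C * r ^+ 2 <= alpha / tau * p ^+ 2 + beta * q ^+ 2.
Proof.
move=> /andP[e0 e1] z0 al0 be0 tau0; rewrite le_eqVlt => /predU1P[<-|C0] p0 q0 r0 eb.
  by move=> _ _; rewrite mul0r addr_ge0 // mulr_ge0 ?sqr_ge0 ?divr_ge0 // ltW.
move=> tau_le r_le.
have eb0 : 0 <= eb by rewrite divr_ge0 ?subr_ge0 // ltW.
have {r_le} : C * r ^+ 2 <= C * zeta ^+ 2 * (p ^+ 2) `^ eta * (q ^+ 2) `^ (1 - eta).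
  have sqE : (zeta * p `^ eta * q `^ (1 - eta)) ^+ 2 =
      zeta ^+ 2 * (p ^+ 2) `^ eta * (q ^+ 2) `^ (1 - eta).
    by rewrite !expr2 !powRM //; ring.
  rewrite -!(mulrA C) ler_pM2l // -sqE ler_pXn2r ?nnegrE //.
  exact: le_trans r_le.
move/le_trans; apply.
have {p p0} [P P0 ->] : exists2 P, 0 <= P & p ^+ 2 = P by exists (p ^+ 2); rewrite ?sqr_ge0.
have {q q0} [Q Q0 ->] : exists2 Q, 0 <= Q & q ^+ 2 = Q by exists (q ^+ 2); rewrite ?sqr_ge0.
move: e1; rewrite le_eqVlt => /predU1P[eta1|e1].
  move: tau_le; rewrite /eb eta1 subrr mul0r !mulr0 !addr0 !powRr0.
  rewrite !powRr1 ?(ltW C0) // !mulr1 powR_mulrn ?(ltW z0) // ler_pdivlMr ?mulr_gt0 ?exprn_gt0 // => tau_le.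
  apply: (@le_trans _ _ (alpha / tau * P)); last first.
    by rewrite lerDl mulr_ge0 // ltW.
  by rewrite ler_wpM2r // ler_pdivlMr // mulrC.
have s0 : 0 < 1 - eta by rewrite subr_gt0.
pose X := alpha / (tau * eta); pose Y := beta / (1 - eta).
have X0 : 0 < X by rewrite divr_gt0 ?mulr_gt0.
have Y0 : 0 < Y by rewrite divr_gt0.
have CXY : C * zeta ^+ 2 <= X `^ eta * Y `^ (1 - eta).
  have eb1 : (1 + eb) * eta = 1 by rewrite /eb; field; rewrite gt_eqF.
  have eb2 : eb * eta = 1 - eta by rewrite /eb; field; rewrite gt_eqF.
  have Cz0 : 0 <= C * zeta ^+ 2 by rewrite mulr_ge0 ?sqr_ge0 // ltW.
  have : (C * zeta ^+ 2) `^ (1 + eb) <= X * Y `^ eb.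
    have -> : X * Y `^ eb = alpha * beta `^ eb / (eta * (1 - eta) `^ eb) / tau.
      have powV : (1 - eta)^-1 `^ eb = ((1 - eta) `^ eb)^-1.
        by rewrite -powR_inv1 ?(ltW s0) // powRAC powR_inv1 ?powR_ge0.
      rewrite /X /Y powRM ?invr_ge0 ?(ltW be0) ?(ltW s0) // powV.
      by field; rewrite ?gt_eqF ?powR_gt0.
    rewrite ler_pdivlMr // mulrC -ler_pdivlMr ?powR_gt0 ?mulr_gt0 ?exprn_gt0 //.
    congr (_ <= _): tau_le.
    rewrite powRM ?sqr_ge0 ?(ltW C0) // -powR_mulrn ?(ltW z0) // -powRrM.
    rewrite mulrDr mulr1.
    by field; rewrite ?gt_eqF ?powR_gt0.
  move/(ge0_ler_powR (ltW e0)); rewrite !nnegrE powR_ge0 mulr_ge0 ?powR_ge0 ?(ltW X0) //.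
  by move/(_ isT isT); rewrite -powRrM eb1 powRr1 // powRM ?powR_ge0 ?(ltW X0) // -powRrM eb2.
apply: (@le_trans _ _ ((X * P) `^ eta * (Y * Q) `^ (1 - eta))).
  rewrite (powRM _ (ltW X0) P0) (powRM _ (ltW Y0) Q0) -mulrA [leRHS]mulrACA.
  by rewrite ler_wpM2r // mulr_ge0 ?powR_ge0.
apply: le_trans (weighted_amgm (mulr_ge0 (ltW X0) P0) (mulr_ge0 (ltW Y0) Q0) _) _.
  by rewrite e0 e1.
rewrite /X /Y le_eqVlt; apply/orP; left; apply/eqP.
by field; rewrite !gt_eqF.
Qed.

End young.

Section defect.
Variables (R : realType) (m : nat) (Bh mu : 'cV[R]_m.+1) (D : nat -> R).
Hypothesis D_ge0 : forall i, 0 <= D i.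

(** c^_i - c^_(i+1) = c~_i, and c^ vanishes past the last index. *)
Lemma chat_telescope :
  \sum_(1 <= i < m.+1) chat Bh mu i * D i.-1
  - \sum_(1 <= i < m.+1) chat Bh mu i * D i
  = chat Bh mu 0 * D 0%N - \sum_(0 <= i < m.+1) ctilde Bh mu i * D i.
Proof.
have chatS i : (i < m.+1)%N -> ctilde Bh mu i = chat Bh mu i - chat Bh mu i.+1.
  by move=> im; rewrite /chat big_ltn // addrK.
have -> : \sum_(0 <= i < m.+1) ctilde Bh mu i * D i =
    \sum_(0 <= i < m.+1) (chat Bh mu i * D i - chat Bh mu i.+1 * D i).
  by apply: eq_big_nat => i /andP[_ im]; rewrite chatS // mulrBl.
have -> : \sum_(1 <= i < m.+1) chat Bh mu i * D i.-1 =
    \sum_(0 <= i < m.+1) chat Bh mu i.+1 * D i.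
  rewrite [RHS]big_nat_recr //= [X in _ + X * _]/chat [X in _ + X * _]big_geq //.
  by rewrite mul0r addr0 big_add1.
by rewrite sumrB [X in _ - (X - _)]big_ltn //; ring.
Qed.

(** D_j stands for |delta u^{n+1-j}|^2.  The left-hand side collects, for each j,
    the Taylor remainder, the increments between the point where f is evaluated
    and u^n, and the extrapolation error.  After exchanging the triangular
    double sum, the coefficients of each D_i are compared; they agree except
    that |mu_j| is replaced by j |mu_j| for j > i >= 1. *)
Lemma ctilde_dominates :
  \sum_(0 <= j < m.+1) `|mu`_[j]| *
     (D j + \sum_(1 <= i < j.+1) (D i + D j)
          + \sum_(1 <= i < m.+1) `|bhat Bh i| * (D i + D j))
  <= \sum_(0 <= i < m.+1) ctilde Bh mu i * D i.
Proof.
pose M i := `|mu`_[i]|; pose b i := `|bhat Bh i|.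
pose e i : R := 1 - (i == 0%N)%:R.
have from0 F : \sum_(1 <= i < m.+1) F i = \sum_(0 <= i < m.+1) e i * F i.
  rewrite [RHS]big_ltn // /e eqxx subrr mul0r add0r.
  by apply: eq_big_nat => -[|i] // _; rewrite subr0 mul1r.
have exch : \sum_(0 <= j < m.+1) M j * (\sum_(1 <= i < j.+1) D i) =
    \sum_(0 <= i < m.+1) e i * ((\sum_(i <= j < m.+1) M j) * D i).
  rewrite -from0; under eq_bigr do rewrite mulr_sumr.
  under [RHS]eq_bigr do rewrite mulr_suml.
  transitivity (\sum_(0 <= j < m.+1) \sum_(1 <= i < m.+1 | (i < j.+1)%N) M j * D i).
    by apply: eq_big_nat => j /andP[_ jm]; rewrite (big_nat_widen _ j.+1 m.+1).
  rewrite (exchange_big_dep_nat xpredT) //=; apply: eq_bigr => i _.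
  by rewrite (big_nat_widenl i 0).
set SM := \sum_(0 <= j < m.+1) M j; set Sb := \sum_(1 <= j < m.+1) b j.
have -> : \sum_(0 <= j < m.+1) `|mu`_[j]| *
     (D j + \sum_(1 <= i < j.+1) (D i + D j)
          + \sum_(1 <= i < m.+1) `|bhat Bh i| * (D i + D j)) =
   \sum_(0 <= i < m.+1) (e i * b i * SM + M i * Sb + M i + i%:R * M i
      + e i * \sum_(i <= j < m.+1) M j) * D i.
  have dbl : \sum_(0 <= j < m.+1) M j * (\sum_(1 <= i < m.+1) b i * D i) =
      \sum_(0 <= i < m.+1) e i * (SM * (b i * D i)).
    by rewrite -from0 -mulr_suml mulr_sumr.
  rewrite [RHS](eq_bigr (fun i => e i * (SM * (b i * D i)) + M i * Sb * D i + M i * D i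
      + i%:R * M i * D i + e i * ((\sum_(i <= j < m.+1) M j) * D i)));
    last by move=> i _; ring.
  rewrite !big_split /= -exch -dbl -!big_split /=; apply: eq_bigr => j _.
  rewrite big_split /= sumr_const_nat subn1 -mulr_natl /=.
  under [X in _ + X]eq_bigr do rewrite mulrDr.
  rewrite [X in _ + X]big_split /= -mulr_suml -/Sb; rewrite /M; ring.
rewrite !big_nat; apply: ler_sum => i /andP[_ im]; rewrite ler_wpM2r //.
rewrite /ctilde -/(M i) -/(b i) -/(e i) -/SM -/Sb -addrA lerD2l //.
rewrite big_ltn // [X in _ <= (_ + X) * _]big_ltn //.
rewrite -/(M i).
case: i im => [|i] im; first by rewrite /e eqxx subrr !mul0r mulr0 addr0.
rewrite /e /= subr0 mul1r mulr1.
have : \sum_(i.+2 <= j < m.+1) M j <= \sum_(i.+2 <= j < m.+1) j%:R * M j.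
  rewrite !big_nat; apply: ler_sum => j /andP[ij _].
  by rewrite ler_peMl ?normr_ge0 // ler1n (leq_trans _ ij).
rewrite /M; lra.
Qed.

End defect.

Section dissipation.
Variables (R : realType) (d m : nat) (E : gradient_flow R d).

(** Extrapolation written as the value at the last known point plus a
    combination of increments. *)
Lemma sum_by_parts (Bh : 'cV[R]_m.+1) (V : lmodType R) (f : nat -> V) :
  \sum_(1 <= i < m.+2) Bh`_[i.-1] = 1 ->
  \sum_(1 <= i < m.+2) Bh`_[i.-1] *: f i
  = f 1%N + \sum_(1 <= i < m.+1) bhat Bh i *: (f i - f i.+1).
Proof.
move=> Bh1; pose S i := \sum_(1 <= j < i.+1) Bh`_[j.-1].
have abel N : \sum_(1 <= i < N.+2) Bh`_[i.-1] *: f i =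
    S N.+1 *: f N.+1 + \sum_(1 <= i < N.+1) S i *: (f i - f i.+1).
  elim: N => [|N IH]; first by rewrite /S !big_nat1 big_geq // addr0.
  rewrite big_nat_recr //= IH [in RHS]big_nat_recr //= /S [in RHS]big_nat_recr //=.
  rewrite -/(S N.+1) scalerDl scalerBr; set s := \sum_(_ <= _ < _) _.
  by rewrite [RHS]addrC !addrA subrK; congr (_ + _); rewrite addrC.
rewrite abel {1}/S Bh1 scale1r.
have -> : f m.+1 = f 1%N - \sum_(1 <= i < m.+1) (f i - f i.+1).
  rewrite -[X in _ - X]opprK -sumrN.
  under eq_bigr do rewrite opprB.
  by rewrite telescope_sumr // opprK addrC subrK.
rewrite -addrA -sumrN -big_split /=; congr (_ + _).
by apply: eq_bigr => i _; rewrite /bhat scalerBl scale1r addrC.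
Qed.

(** Cauchy-Schwarz, the Lipschitz bound and 2 p q <= p^2 + q^2. *)
Lemma f_lipschitz_young (v w : spS E) (h : spH E) :
  `|inner h (iVH E (opf v) - iVH E (opf w))|
  <= lipf E / 2 * (`|iSH v - iSH w| ^+ 2 + `|h| ^+ 2).
Proof.
apply: le_trans (inner_cauchy_schwarz _ _) _.
apply: (@le_trans _ _ (`|h| * (lipf E * `|iSH v - iSH w|))).
  by rewrite ler_wpM2l // f_lipschitz.
have l0 := lipf_gt0 E; set p := `|h|; set q := `|_ - _|.
have : 0 <= lipf E / 2 * (p - q) ^+ 2 by rewrite mulr_ge0 ?sqr_ge0 // divr_ge0 // ltW.
have -> : lipf E / 2 * (p - q) ^+ 2 =
   lipf E / 2 * (q ^+ 2 + p ^+ 2) - p * (lipf E * q) by field.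
by rewrite subr_ge0.
Qed.

(** Each increment tested with the explicit term reproduces the increment of the
    potential: by Taylor at the earlier endpoint, by telescoping the values of f
    from there to the last known point, and by [sum_by_parts]. *)
Lemma nonlinear_defect (Bh mu : 'cV[R]_m.+1) (x : nat -> spS E) (step : nat -> spH E) :
  \sum_(1 <= i < m.+2) Bh`_[i.-1] = 1 ->
  (forall i, step i = iSH (x i) - iSH (x i.+1)) ->
  \sum_(0 <= i < m.+1) mu`_[i] * (intF (x i) - intF (x i.+1))
    - lipf E / 2 * \sum_(0 <= i < m.+1) ctilde Bh mu i * `|step i| ^+ 2
  <= inner (\sum_(i < m.+1) mu i 0 *: step i)
       (\sum_(1 <= i < m.+2) Bh`_[i.-1] *: iVH E (opf (x i))).
Proof.
move=> Bh1 stepE; pose f i := iVH E (opf (x i)); pose D i := `|step i| ^+ 2.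
have l0 : 0 < lipf E / 2 by rewrite divr_gt0 ?lipf_gt0.
have [_ sym _] := inner_psd (spH E).
have lip i j : `|inner (step j) (f i - f i.+1)| <= lipf E / 2 * (D i + D j).
  by rewrite /D (stepE i); exact: f_lipschitz_young.
have one j : `|inner (step j) (\sum_(1 <= i < m.+2) Bh`_[i.-1] *: f i)
      - (intF (x j) - intF (x j.+1))| <=
    lipf E / 2 * (D j + \sum_(1 <= i < j.+1) (D i + D j)
          + \sum_(1 <= i < m.+1) `|bhat Bh i| * (D i + D j)).
  (* index 1 is u^n, index j+1 the earlier endpoint of the j-th increment *)
  have fE : f 1%N = f j.+1 + \sum_(1 <= i < j.+1) (f i - f i.+1).
    rewrite -[X in _ + X]opprK -sumrN.
    under eq_bigr do rewrite opprB.
    by rewrite telescope_sumr // opprB addrC subrK.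
  rewrite sum_by_parts // fE !(psd_formDr (inner_psd _)) !(psd_form_sumr (inner_psd _)).
  have ft := f_taylor (x j) (x j.+1); rewrite -stepE -/(f j.+1) -/(D j) sym in ft.
  set s1 := \sum_(1 <= i < j.+1) _; set s2 := \sum_(1 <= i < m.+1) _.
  have -> : inner (step j) (f j.+1) + s1 + s2 - (intF (x j) - intF (x j.+1)) =
    - (intF (x j) - intF (x j.+1) - inner (step j) (f j.+1)) + s1 + s2 by ring.
  rewrite 2!mulrDr (le_trans (ler_normD _ _)) // lerD //.
    rewrite (le_trans (ler_normD _ _)) // normrN lerD //.
    rewrite mulr_sumr (le_trans (ler_norm_sum _ _ _)) //.
    by apply: ler_sum => i _; exact: lip.
  rewrite mulr_sumr (le_trans (ler_norm_sum _ _ _)) //.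
  apply: ler_sum => i _; rewrite (psd_formZr (inner_psd _)) normrM mulrCA.
  by rewrite ler_wpM2l.
rewrite (psd_form_suml (inner_psd _)) lerBlDr.
have -> : \sum_(0 <= i < m.+1) mu`_[i] * (intF (x i) - intF (x i.+1)) =
  \sum_(i < m.+1) mu i 0 * (intF (x i) - intF (x i.+1)).
  by rewrite big_mkord; apply: eq_bigr => i _; rewrite entryE.
rewrite -lerBlDl -sumrB.
have D0 i : 0 <= D i by exact: sqr_ge0.
apply: le_trans (ler_wpM2l (ltW l0) (ctilde_dominates Bh mu D0)).
rewrite big_mkord mulr_sumr; apply: ler_sum => i _.
rewrite (psd_formZl (inner_psd _)) -mulrBr entryE mulrCA.
apply: le_trans (ler_norm _) _; rewrite normrM ler_wpM2l //.
by rewrite distrC; exact: one.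
Qed.

End dissipation.

(** * Energy dissipation *)

Section decay.
Variables (R : realType) (d m : nat) (E : gradient_flow R d).
Variables (A B : 'cV[R]_m.+2) (Bh mu : 'cV[R]_m.+1).

Lemma energyE tau (u : nat -> spS E) Ga GB n :
  energy Bh mu tau u Ga GB n =
  tau^-1 * gform Ga (@Mform _ _ E) (fun i => delta u (n - i))
  + gform GB (@Lform _ _ E) (fun i => u (n - i)%N)
  + \sum_(0 <= i < m.+1) mu`_[i] * intF (u (n - i)%N)
  + lipf E / 2 * \sum_(1 <= i < m.+1) chat Bh mu i * `|delta u (n.+1 - i)| ^+ 2.
Proof.
rewrite /energy; congr (_ + _ + _ + _); rewrite mulNr -mulrN; congr (_ * _).
rewrite /inner_G /gform -sumrN; apply: eq_bigr => i _; rewrite -sumrN.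
apply: eq_bigr => j _.
by rewrite /Mform (psd_formNr (inner_psd _)) mulrN.
Qed.

(** The scheme is an equation in V'; it is evaluated at M^-1 h, and the symmetry
    of M moves M^-1 off the chemical potential. *)
Lemma invMH_test tau (u : nat -> spS E) N n (h : spH E) :
  imex_lmm A B Bh tau u N -> (m <= n < N)%N ->
  - Mform (\sum_(i < m.+2) A i 0 *: iSH (u (n.+1 - i)%N)) h =
  tau * inner h (\sum_(i < m.+2) B i 0 *: iVH E (opL E (u (n.+1 - i)%N))
     + \sum_(1 <= i < m.+2) Bh`_[i.-1] *: iVH E (opf (u (n.+1 - i)%N))).
Proof.
move=> /(_ n) scheme /scheme {scheme}.
move=> /(congr1 (fun g => g (invM (iHV' h)))).
set q := (X in tau *: opM E X) => scheme.
transitivity ((tau *: opM E q) (invM (iHV' h))); last first.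
  rewrite /GRing.scale /= opM_symmetric opM_invM /iHV' /q linearD !linear_sum /= big_mkord.
  congr (_ * inner h (_ + _)).
    by apply: eq_bigr => i _; rewrite linearZ entryE.
  by apply: eq_bigr => i _; rewrite linearZ.
rewrite -scheme big_mkord fct_sumE /Mform (psd_formNr (inner_psd _)) opprK.
rewrite (psd_form_suml (inner_psd _)); apply: eq_bigr => i _.
by rewrite (psd_formZl (inner_psd _)) entryE.
Qed.

Lemma tested_scheme tau (u : nat -> spS E) N n :
  tau != 0 -> \sum_(0 <= i < m.+2) A`_[i] = 0 ->
  imex_lmm A B Bh tau u N -> (m <= n < N)%N ->
  let x i := u (n.+1 - i)%N in
  let step i := delta u (n.+1 - i) in
  let h := \sum_(i < m.+1) mu i 0 *: step i in
  tau^-1 * Mform h (\sum_(i < m.+1) a_coef A i 0 *: step i)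
  + Lform (\sum_(i < m.+2) nu_coef mu i 0 *: x i) (\sum_(i < m.+2) B i 0 *: x i)
  + inner h (\sum_(1 <= i < m.+2) Bh`_[i.-1] *: iVH E (opf (x i))) = 0.
Proof.
move=> tau0 A0 scheme mn x step h.
have stepE i : step i = iSH (x i) - iSH (x i.+1) by rewrite /step /delta /x subnS.
have := invMH_test h scheme mn.
rewrite -{1}(nu_a_coef A0) (sum_nu_coef _ (fun i => iSH (u (n.+1 - i)%N))).
have [_ sym _] := @Mform_psd _ _ E; rewrite sym.
have hE : h = iSH (\sum_(i < m.+2) nu_coef mu i 0 *: x i).
  rewrite /iSH !linear_sum /= (eq_bigr (fun i : 'I_m.+2 => nu_coef mu i 0 *: iSH (x i))).
    by rewrite (sum_nu_coef _ (fun i => iSH (x i))); apply: eq_bigr => i _; rewrite stepE.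
  by move=> i _; rewrite !linearZ.
have -> : Lform (\sum_(i < m.+2) nu_coef mu i 0 *: x i) (\sum_(i < m.+2) B i 0 *: x i)
   = inner h (\sum_(i < m.+2) B i 0 *: iVH E (opL E (x i))).
  rewrite /Lform -hE; congr (inner h _); rewrite !linear_sum /=.
  by apply: eq_bigr => i _; rewrite !linearZ.
move=> e; rewrite -addrA -(psd_formDr (inner_psd _)) -[inner h _](mulKf tau0) -e mulrN.
rewrite (eq_bigr (fun i : 'I_m.+1 => a_coef A i 0 *: (iSH (x i) - iSH (x i.+1)))).
  by rewrite subrr.
by move=> i _; rewrite stepE.
Qed.

Lemma chat_ge0 i : 0 <= chat Bh mu i.
Proof.
apply: sumr_ge0 => j _; rewrite /ctilde.
have e0 : 0 <= 1 - (j == 0%N)%:R :> R by case: (j == 0%N); rewrite ?subrr ?subr0.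
have M0 a b : 0 <= \sum_(a <= k < b) `|mu`_[k]| by apply: sumr_ge0.
have b0 a b : 0 <= \sum_(a <= k < b) `|bhat Bh k| by apply: sumr_ge0.
have jM0 a b : 0 <= \sum_(a <= k < b) k%:R * `|mu`_[k]|.
  by apply: sumr_ge0 => k _; rewrite mulr_ge0.
by rewrite !addr_ge0 // !mulr_ge0 // addr_ge0.
Qed.

(** The four estimates add up: the two positive-definiteness inequalities, the
    bound on the nonlinear term and the absorption of l/2 c^_0 |delta u^{n+1}|^2;
    what remains of the tested scheme is the difference of the energies. *)
Theorem energy_decay alpha beta (Ga : 'M[R]_m) (GB : 'M[R]_m.+1)
    tau (u : nat -> spS E) N n :
  0 < alpha -> 0 < beta ->
  \sum_(0 <= i < m.+2) A`_[i] = 0 -> \sum_(1 <= i < m.+2) Bh`_[i.-1] = 1 ->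
  Ga^T = Ga -> GB^T = GB -> pos_def_conditions A B mu alpha beta Ga GB ->
  0 < tau -> tau <= tau_max E Bh mu alpha beta ->
  imex_lmm A B Bh tau u N -> (m <= n < N)%N ->
  energy Bh mu tau u Ga GB n.+1 <= energy Bh mu tau u Ga GB n.
Proof.
move=> al0 be0 A0 Bh1 Gas GBs pd tau0 tau_le scheme mn.
pose x i := u (n.+1 - i)%N; pose step i := delta u (n.+1 - i).
have stepE i : step i = iSH (x i) - iSH (x i.+1) by rewrite /step /delta /x subnS.
pose D i := `|step i| ^+ 2.
have Kpsd := @Mform_psd _ _ E; have Lpsd := @Lform_psd _ _ E.
pose y := x 0%N - x 1%N.
have young : lipf E * chat Bh mu 0 / 2 * D 0%N
    <= alpha / tau * Mform (step 0%N) (step 0%N) + beta * Lform y y.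
  have [_ _ Kge0] := Kpsd; have [_ _ Lge0] := Lpsd.
  have step0 : iSH y = step 0%N by rewrite stepE /iSH /y !linearB.
  have normM2 : Mform (step 0%N) (step 0%N) = normM (iSH y) ^+ 2.
    by rewrite step0 sqr_sqrtr //; exact: Kge0.
  have normL2 : Lform y y = normL y ^+ 2.
    have [_ sym _] := inner_psd (spH E).
    by rewrite /Lform sym sqr_sqrtr //; exact: opL_ge0.
  rewrite normM2 normL2 /D -step0.
  apply: interpolation_absorb tau_le (interpolation y) => //; rewrite ?sqrtr_ge0 //.
  - exact: eta_bounds.
  - exact: zeta_gt0.
  - by rewrite divr_ge0 // mulr_ge0 ?(ltW (lipf_gt0 E)) ?chat_ge0.
have telescope : \sum_(1 <= i < m.+1) chat Bh mu i * `|delta u (n.+2 - i)| ^+ 2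
    - \sum_(1 <= i < m.+1) chat Bh mu i * `|delta u (n.+1 - i)| ^+ 2
    = chat Bh mu 0 * D 0%N - \sum_(0 <= i < m.+1) ctilde Bh mu i * D i.
  rewrite -chat_telescope; congr (_ - _); apply: eq_big_nat => -[|i] // _.
have potentials : \sum_(0 <= i < m.+1) mu`_[i] * (intF (x i) - intF (x i.+1)) =
    \sum_(0 <= i < m.+1) mu`_[i] * intF (u (n.+1 - i)%N)
    - \sum_(0 <= i < m.+1) mu`_[i] * intF (u (n - i)%N).
  by rewrite -sumrB; apply: eq_bigr => i _; rewrite mulrBr.
have := tested_scheme (lt0r_neq0 tau0) A0 scheme mn.
rewrite /= -/x -/step.
rewrite (multiplier_identity mu (a_coef A) Ga (fun i : 'I_m.+1 => step i) Kpsd).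
rewrite (multiplier_identity (nu_coef mu) B GB (fun i : 'I_m.+2 => x i) Lpsd).
have := pos_def_form_a pd Kpsd (fun i : 'I_m.+1 => step i) Gas.
have := pos_def_form_B pd Lpsd (fun i : 'I_m.+2 => x i) GBs.
have := nonlinear_defect mu Bh1 stepE.
rewrite !energyE potentials.
set I := inner _ _; set Ua := gform (U_mx mu _ _) _ _; set UB := gform (U_mx _ B _) _ _.
move=> hI hB hA identity.
have {}hB : beta * Lform y y <= UB by exact: hB.
have {}hA : alpha * Mform (step 0%N) (step 0%N) <= Ua by exact: hA.
have {}hA : alpha / tau * Mform (step 0%N) (step 0%N) <= tau^-1 * Ua.
  by rewrite mulrC mulrA [_ * tau^-1]mulrC ler_wpM2l ?invr_ge0 ?(ltW tau0) // mulrC.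
have {}telescope := congr1 ( *%R (lipf E / 2)) telescope.
move: young telescope hI hB hA identity.
(* the windows of the identity are those of the energies at n+1 and at n *)
rewrite (_ : (fun i : 'I_m => step (widen_ord (leqnSn m) i))
  = (fun i => delta u (n.+1 - i))) //.
rewrite (_ : (fun i : 'I_m => step (lift ord0 i)) = (fun i => delta u (n - i))) //.
rewrite (_ : (fun i : 'I_m.+1 => x (widen_ord (leqnSn m.+1) i))
  = (fun i => u (n.+1 - i)%N)) //.
rewrite (_ : (fun i : 'I_m.+1 => x (lift ord0 i)) = (fun i => u (n - i)%N)) //.
move: (gform Ga _ _) (gform Ga _ _) (gform GB _ _) (gform GB _ _) => a1 a0 b1 b0.
move: (Mform _ _) (Lform _ _) I Ua UB (D 0%N) => p q {}I {}Ua {}UB D0.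
rewrite -/D.
move: (lipf E) tau^-1 (chat Bh mu 0) => l t c0.
set s1 := \sum_(1 <= i < m.+1) _; set s2 := \sum_(1 <= i < m.+1) _.
set f1 := \sum_(0 <= i < m.+1) _; set f2 := \sum_(0 <= i < m.+1) _.
set s3 := \sum_(0 <= i < m.+1) _.
move: s1 s2 f1 f2 s3 => s1 s2 f1 f2 s3.
lra.
Qed.

End decay.

Theorem proposition4p2 (R : realType) :
  let A := wsbdf7_A R in
  let B := wsbdf7_B R in
  let Bh := wsbdf7_Bh R in
  let mu := wsbdf7_mu R in
  let Ga := wsbdf7_Ga R in
  let GB := wsbdf7_GB R in
  let alpha : R := 1 / 4 in
  let beta : R := 1 / 100 in
  [/\ order_conditions A B Bh /\ feasible A B mu alpha beta,
      posdef Ga /\ posdef GB,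
      pos_def_conditions A B mu alpha beta Ga GB,
      chat Bh mu 0 = ofZ R 33856%BZ / 5
    & forall (d : nat) (E : gradient_flow R d) (T : R) (N : nat)
        (u : nat -> spS E),
      (1 <= d <= 3)%N -> 0 < T -> (0 < N)%N ->
      let tau := T / N%:R in
      tau <= tau_max E Bh mu alpha beta ->
      imex_lmm A B Bh tau u N ->
      forall n : nat, (6 <= n < N)%N ->
      energy Bh mu tau u Ga GB n.+1 <= energy Bh mu tau u Ga GB n].
Proof.
move=> A B Bh mu Ga GB alpha beta.
have order : order_conditions A B Bh := wsbdf7_order R.
have [pGa pGB] : posdef Ga /\ posdef GB := wsbdf7_posdef R.
have pdc : pos_def_conditions A B mu alpha beta Ga GB
  := wsbdf7_pos_def_conditions R.
have [copa copB] : coprimep (genpoly (a_coef A)) (genpoly mu)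
    /\ coprimep (genpoly B) (genpoly (nu_coef mu)) := wsbdf7_coprime R.
have [A_sum _ _ B_sum Bh_sum] := order.
have alpha_gt0 : 0 < alpha by rewrite divr_gt0.
have beta_gt0 : 0 < beta by rewrite divr_gt0.
split=> //; last first.
- move=> d E T N u _ T_gt0 N_gt0 tau tau_le scheme n n_bounds.
  have tau_gt0 : 0 < tau by rewrite divr_gt0 ?ltr0n.
  exact: (energy_decay alpha_gt0 beta_gt0 A_sum Bh_sum pGa.1 pGB.1 pdc tau_gt0
    tau_le scheme n_bounds).
- exact: wsbdf7_chat.
- split=> //; apply: feasible_of_pos_def pdc => //.
  + exact: wsbdf7_mu_sum.
  + by rewrite /A wsbdf7_AE !mxE mulf_neq0 ?invr_neq0 ?ofZ_neq0.
  + by rewrite /B wsbdf7_BE !mxE mulf_neq0 ?invr_neq0 ?ofZ_neq0.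
  + by rewrite /mu wsbdf7_muE !mxE mulf_neq0 ?invr_neq0 ?ofZ_neq0.
Qed.
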